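(* Let $L>0$ and let $\theta$, on an interval $I\ni0$, be a solution of $$w'+w^2+\frac{\cos\theta}{L}w-k_1^2-\frac{\sin^2\theta}{L^2}-\frac2{L^2}=0,\qquad w=-\frac{H'}{k_1},\quad k_1=\theta'+\frac{\sin\theta}{L}\neq0,\quad H=\frac{\theta'}2+\frac{\sin\theta}{L}.$$ Let $\rho(s)=\rho_0\exp\bigl[\frac1L\int_0^s\cos\theta\,d\tau\bigr]$ with $\rho_0>0$, let $Z$ solve $$Z'=\frac{\cos\theta}LZ+\sin\theta,\qquad Z(0)=Z_0,$$ set $V=\frac{L^2+Z^2}{2\rho}$, and, in null coordinates $(U,V,Y,Z)$ of $\mathbb R^{2,2}$ with metric $-2\,dU\,dV-dY^2+dZ^2$, define $$X(s,t)=\Bigl(\rho,\;V-\tfrac12t^2\rho,\;t\rho,\;Z\Bigr),\qquad(s,t)\in I\times J,$$ with $J\subset\mathbb R$ an interval. Then $X$ takes values in $\mathrm{AdS}_3(L)$ and has induced metric $g=ds^2-\rho(s)^2dt^2$. With a suitable spacelike unit normal, its principal curvatures (along $\partial_s$ and $\partial_t$ respectively) are $$k_1=\theta'+\frac{\sin\theta}L,\qquad k_2=\frac{\sin\theta}L.$$ Consequently, let $\theta$ be the local real-analytic solution with initial data $\theta(0)=\theta_0$, $\theta'(0)=a_0$, $\theta''(0)=b_0$ satisfying $k_{1,0}\neq0$, $H_0\neq0$, $H'_0\neq0$, $H_0\neq-k_{1,0}$, where $k_{1,0}=a_0+\frac{\sin\theta_0}L$, $H_0=\frac{a_0}2+\frac{\sin\theta_0}L$,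 $H_0'=\frac{b_0}2+\frac{a_0\cos\theta_0}L$; let $u(s)=u_0\exp\bigl[-\int_0^s\frac{H'}{k_1}d\tau\bigr]$ with $u_0/H_0>0$, let $\lambda^2=u/H$, and let $I$ be a sufficiently small interval around $0$. Then $$X:\bigl(I\times J,\lambda^{-2}(ds^2-\rho^2dt^2)\bigr)\to\mathrm{AdS}_3(L)$$ is a proper biharmonic conformal immersion with timelike parabolic symmetry.
   Context: In the null coordinates $(U,V,Y,Z)$, $\mathbb R^{2,2}$ has scalar product $\langle X,X\rangle=-2UV-Y^2+Z^2$, and $\mathrm{AdS}_3(L)=\{\langle X,X\rangle=-L^2\}$ with the induced Lorentzian metric of constant curvature $-1/L^2$. The immersion is $X(s,t)=\widetilde{\mathcal P}_t(\rho(s),V(s),0,Z(s))$, where $\widetilde{\mathcal P}_t(U,V,Y,Z)=(U,\,V-tY-\frac12t^2U,\,Y+tU,\,Z)$ is a one-parameter subgroup of $O(2,2)$ whose generator $\mathcal B$ satisfies $\mathcal B^3=0$, $\mathcal B^2\neq0$; timelike parabolic symmetry refers to this action (its orbits on the surface are timelike). The shape operator is $A$ with $\nabla^N_W\xi=-AW$ for the unit normal $\xi$ ($\langle\xi,\xi\rangle=+1$), the principal curvatures are its eigenvalues, and the scalar mean curvature is $H=\frac12\operatorname{tr}_gA$ (mean-curvature vector $=H\xi$). For a smooth map $\phi:(M,g')\to(N,h)$ between pseudo-Riemannian manifolds, $\tau_{g'}(\phi)=\operatorname{tr}_{g'}\nabla d\phi$ and $\tau_{2,g'}(\phi)=\Delta^\phi_{g'}\tau_{g'}(\phi)-\sum_i\epsilon_iR^N(d\phi(e_i),\tau_{g'}(\phi))d\phi(e_i)$,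 where $\{e_i\}$ is a local $g'$-pseudo-orthonormal frame with $g'(e_i,e_j)=\epsilon_i\delta_{ij}$, $\Delta^\phi_{g'}V=\sum_i\epsilon_i(\nabla^\phi_{e_i}\nabla^\phi_{e_i}V-\nabla^\phi_{\nabla_{e_i}e_i}V)$, and $R^N(X,Y)=[\nabla^N_X,\nabla^N_Y]-\nabla^N_{[X,Y]}$. The map is biharmonic if $\tau_{2,g'}(\phi)=0$; proper biharmonic means biharmonic but not harmonic ($\tau_{g'}(\phi)\not\equiv0$). Primes denote $d/ds$. *)

(* Defs.v *)
From Stdlib Require Import Reals.
From Coquelicot Require Import Coquelicot.
Open Scope R_scope.

Record vec4 := mkvec4 { cU : R; cV : R; cY : R; cZ : R }.

Definition vzero : vec4 := mkvec4 0 0 0 0.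
Definition vadd (x y : vec4) : vec4 :=
  mkvec4 (cU x + cU y) (cV x + cV y) (cY x + cY y) (cZ x + cZ y).
Definition vscal (a : R) (x : vec4) : vec4 :=
  mkvec4 (a * cU x) (a * cV x) (a * cY x) (a * cZ x).
Definition vsub (x y : vec4) : vec4 := vadd x (vscal (-1) y).

(* The polarization of -2UV - Y^2 + Z^2. *)
Definition ip (x y : vec4) : R :=
  - (cU x * cV y + cV x * cU y) - cY x * cY y + cZ x * cZ y.

Definition AdS3 (L : R) (p : vec4) : Prop := ip p p = - L ^ 2.

(* The orthogonal projection of R^{2,2} onto T_p AdS_3(L), when p is in
   AdS_3(L): it is w - (<w,p>/<p,p>) p, and <p,p> = -L^2. *)
Definition projT (L : R) (p w : vec4) : vec4 :=
  vadd w (vscal (ip w p / L ^ 2) p).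

(* As AdS_3(L) is a nondegenerate hypersurface with the induced metric, its
   Levi-Civita connection is the tangential part of the flat connection of
   R^{2,2}.  Vector fields on AdS_3(L) are represented by extensions to R^4. *)

Definition dirD (F : vec4 -> vec4) (p v : vec4) : vec4 :=
  let q h := F (vadd p (vscal h v)) in
  mkvec4 (Derive (fun h => cU (q h)) 0) (Derive (fun h => cV (q h)) 0)
         (Derive (fun h => cY (q h)) 0) (Derive (fun h => cZ (q h)) 0).

Definition nablaN (L : R) (X Y : vec4 -> vec4) (p : vec4) : vec4 :=
  projT L p (dirD Y p (X p)).

Definition bracketN (X Y : vec4 -> vec4) (p : vec4) : vec4 :=
  vsub (dirD Y p (X p)) (dirD X p (Y p)).

Definition curvN (L : R) (X Y Z : vec4 -> vec4) (p : vec4) : vec4 :=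
  vsub (vsub (nablaN L X (nablaN L Y Z) p) (nablaN L Y (nablaN L X Z) p))
       (nablaN L (bracketN X Y) Z p).

(* The curvature tensor at p on vectors x, y, z tangent to AdS_3(L): by
   tensoriality any extensions to tangent vector fields may be used; here
   x is extended by q |-> projT L q x, which has the value x at q = p. *)
Definition RN (L : R) (p x y z : vec4) : vec4 :=
  curvN L (fun q => projT L q x) (fun q => projT L q y)
          (fun q => projT L q z) p.

Inductive idx := i_s | i_t.

Definition idx_eqb (i j : idx) : bool :=
  match i, j with i_s, i_s => true | i_t, i_t => true | _, _ => false end.

Definition sum2 (f : idx -> R) : R := f i_s + f i_t.
Definition vsum2 (f : idx -> vec4) : vec4 := vadd (f i_s) (f i_t).

Definition pd (i : idx) (f : R -> R -> R) : R -> R -> R :=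
  match i with
  | i_s => fun s t => Derive (fun x => f x t) s
  | i_t => fun s t => Derive (fun x => f s x) t
  end.

Definition pd4 (i : idx) (F : R -> R -> vec4) (s t : R) : vec4 :=
  mkvec4 (pd i (fun a b => cU (F a b)) s t) (pd i (fun a b => cV (F a b)) s t)
         (pd i (fun a b => cY (F a b)) s t) (pd i (fun a b => cZ (F a b)) s t).

Definition open_2d (Om : R -> R -> Prop) : Prop :=
  forall s t, Om s t -> locally_2d Om s t.

Definition smooth (Om : R -> R -> Prop) (f : R -> R -> R) : Prop :=
  forall s t, Om s t -> forall n, ex_diff_n f n s t.

Definition smooth4 (Om : R -> R -> Prop) (F : R -> R -> vec4) : Prop :=
  smooth Om (fun s t => cU (F s t)) /\ smooth Om (fun s t => cV (F s t)) /\
  smooth Om (fun s t => cY (F s t)) /\ smooth Om (fun s t => cZ (F s t)).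

(* Vector fields, metrics and endomorphism fields by their components in the coordinates (s,t). *)
Definition vfield := idx -> R -> R -> R.
Definition metric := idx -> idx -> R -> R -> R.
Definition endo := idx -> idx -> R -> R -> R.

Definition coord (i : idx) : vfield :=
  fun j _ _ => if idx_eqb i j then 1 else 0.

Definition gprod (g : metric) (W W' : vfield) (s t : R) : R :=
  sum2 (fun i => sum2 (fun j => g i j s t * W i s t * W' j s t)).

Definition gdet (g : metric) (s t : R) : R :=
  g i_s i_s s t * g i_t i_t s t - g i_s i_t s t * g i_t i_s s t.

Definition pseudo_riemannian (Om : R -> R -> Prop) (g : metric) : Prop :=
  (forall i j, smooth Om (g i j)) /\
  (forall s t, Om s t -> (forall i j, g i j s t = g j i s t) /\ gdet g s t <> 0).

Definition ginv (g : metric) : metric := fun i j s t =>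
  match i, j with
  | i_s, i_s => g i_t i_t s t / gdet g s t
  | i_t, i_t => g i_s i_s s t / gdet g s t
  | _, _ => - g i j s t / gdet g s t
  end.

Definition christoffel (g : metric) (k i j : idx) (s t : R) : R :=
  / 2 * sum2 (fun l => ginv g k l s t *
    (pd i (g j l) s t + pd j (g i l) s t - pd l (g i j) s t)).

Definition nablaM (g : metric) (W W' : vfield) : vfield := fun k s t =>
  sum2 (fun i => W i s t *
    (pd i (W' k) s t + sum2 (fun j => christoffel g k i j s t * W' j s t))).

Definition ortho_frame (Om : R -> R -> Prop) (g : metric)
    (e : idx -> vfield) (eps : idx -> R) : Prop :=
  (forall i k, smooth Om (e i k)) /\
  (forall i, eps i = 1 \/ eps i = -1) /\
  (forall i j s t, Om s t ->
     gprod g (e i) (e j) s t = if idx_eqb i j then eps i else 0).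

Definition dmap (phi : R -> R -> vec4) (W : vfield) (s t : R) : vec4 :=
  vsum2 (fun i => vscal (W i s t) (pd4 i phi s t)).

(* The pull-back by phi of the Levi-Civita connection of AdS_3(L): F is a vector
   field along phi. *)
Definition nablaPhi (L : R) (phi : R -> R -> vec4) (W : vfield)
    (F : R -> R -> vec4) (s t : R) : vec4 :=
  projT L (phi s t) (vsum2 (fun i => vscal (W i s t) (pd4 i F s t))).

Definition second_form (L : R) (g : metric) (phi : R -> R -> vec4)
    (W W' : vfield) (s t : R) : vec4 :=
  vsub (nablaPhi L phi W (dmap phi W') s t) (dmap phi (nablaM g W W') s t).

Definition tension (L : R) (g : metric) (phi : R -> R -> vec4)
    (s t : R) : vec4 :=
  vsum2 (fun i => vsum2 (fun j =>
    vscal (ginv g i j s t) (second_form L g phi (coord i) (coord j) s t))).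

Definition rough_laplacian (L : R) (g : metric) (phi : R -> R -> vec4)
    (e : idx -> vfield) (eps : idx -> R) (F : R -> R -> vec4)
    (s t : R) : vec4 :=
  vsum2 (fun i => vscal (eps i)
    (vsub (nablaPhi L phi (e i) (nablaPhi L phi (e i) F) s t)
          (nablaPhi L phi (nablaM g (e i) (e i)) F s t))).

Definition bitension (L : R) (g : metric) (phi : R -> R -> vec4)
    (e : idx -> vfield) (eps : idx -> R) (s t : R) : vec4 :=
  vsub (rough_laplacian L g phi e eps (tension L g phi) s t)
       (vsum2 (fun i => vscal (eps i)
          (RN L (phi s t) (dmap phi (e i) s t) (tension L g phi s t)
                (dmap phi (e i) s t)))).

Definition harmonic (L : R) (Om : R -> R -> Prop) (g : metric)
    (phi : R -> R -> vec4) : Prop :=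
  forall s t, Om s t -> tension L g phi s t = vzero.

(* The bitension field does not depend on the frame; its vanishing is required
   in every local pseudo-orthonormal frame. *)
Definition biharmonic (L : R) (Om : R -> R -> Prop) (g : metric)
    (phi : R -> R -> vec4) : Prop :=
  forall (Om' : R -> R -> Prop) (e : idx -> vfield) (eps : idx -> R),
    open_2d Om' -> (forall s t, Om' s t -> Om s t) ->
    ortho_frame Om' g e eps ->
    forall s t, Om' s t -> bitension L g phi e eps s t = vzero.

Definition proper_biharmonic (L : R) (Om : R -> R -> Prop) (g : metric)
    (phi : R -> R -> vec4) : Prop :=
  biharmonic L Om g phi /\ ~ harmonic L Om g phi.

Definition maps_to_AdS3 (L : R) (Om : R -> R -> Prop)
    (phi : R -> R -> vec4) : Prop :=
  smooth4 Om phi /\ forall s t, Om s t -> AdS3 L (phi s t).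

Definition pullback (phi : R -> R -> vec4) : metric :=
  fun i j s t => ip (pd4 i phi s t) (pd4 j phi s t).

Definition induced_metric (Om : R -> R -> Prop) (phi : R -> R -> vec4)
    (g : metric) : Prop :=
  forall i j s t, Om s t -> pullback phi i j s t = g i j s t.

Definition conformal_immersion (L : R) (Om : R -> R -> Prop) (g : metric)
    (phi : R -> R -> vec4) : Prop :=
  pseudo_riemannian Om g /\ maps_to_AdS3 L Om phi /\
  (forall s t, Om s t -> forall W : vfield,
     dmap phi W s t = vzero -> forall i, W i s t = 0) /\
  (exists mu : R -> R -> R,
     (forall s t, Om s t -> 0 < mu s t) /\
     induced_metric Om phi (fun i j s t => mu s t * g i j s t)).

Definition unit_spacelike_normal (Om : R -> R -> Prop)
    (phi xi : R -> R -> vec4) : Prop :=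
  smooth4 Om xi /\
  forall s t, Om s t ->
    ip (xi s t) (phi s t) = 0 /\
    (forall i, ip (xi s t) (pd4 i phi s t) = 0) /\
    ip (xi s t) (xi s t) = 1.

(* [A j i] is the component along the j-th coordinate field of the image under
   the shape operator of the i-th one. *)
Definition apply_endo (A : endo) (W : vfield) : vfield :=
  fun j s t => sum2 (fun i => A j i s t * W i s t).

Definition shape_operator (L : R) (Om : R -> R -> Prop)
    (phi xi : R -> R -> vec4) (A : endo) : Prop :=
  forall W s t, Om s t ->
    nablaPhi L phi W xi s t = vscal (-1) (dmap phi (apply_endo A W) s t).

Definition principal_curvature (A : endo) (W : vfield) (k s t : R) : Prop :=
  (exists i, W i s t <> 0) /\
  forall j, apply_endo A W j s t = k * W j s t.

Definition Pt (t : R) (x : vec4) : vec4 :=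
  mkvec4 (cU x) (cV x - t * cY x - / 2 * t ^ 2 * cU x) (cY x + t * cU x) (cZ x).

Definition parabolic_subgroup (P : R -> vec4 -> vec4) : Prop :=
  (forall t a x y, P t (vadd (vscal a x) y) = vadd (vscal a (P t x)) (P t y)) /\
  (forall t x y, ip (P t x) (P t y) = ip x y) /\
  (forall x, P 0 x = x) /\
  (forall t t' x, P (t + t') x = P t (P t' x)) /\
  (exists B : vec4 -> vec4,
     (forall x, is_derive (fun t => cU (P t x)) 0 (cU (B x)) /\
                is_derive (fun t => cV (P t x)) 0 (cV (B x)) /\
                is_derive (fun t => cY (P t x)) 0 (cY (B x)) /\
                is_derive (fun t => cZ (P t x)) 0 (cZ (B x))) /\
     (forall x, B (B (B x)) = vzero) /\
     (exists x, B (B x) <> vzero)).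

Definition timelike_parabolic_symmetry (P : R -> vec4 -> vec4)
    (Om : R -> R -> Prop) (phi : R -> R -> vec4) : Prop :=
  parabolic_subgroup P /\
  (exists gamma : R -> vec4, forall s t, Om s t -> phi s t = P t (gamma s)) /\
  (forall s t, Om s t -> ip (pd4 i_t phi s t) (pd4 i_t phi s t) < 0).

Definition is_open_interval (J : R -> Prop) : Prop :=
  open J /\ (exists x, J x) /\
  (forall x y z, J x -> J z -> x <= y <= z -> J y).

Definition rect (J K : R -> Prop) : R -> R -> Prop := fun s t => J s /\ K t.

Definition real_analytic (J : R -> Prop) (f : R -> R) : Prop :=
  forall x, J x -> exists (a : nat -> R) (r : posreal),
    forall y, Rabs (y - x) < r -> is_pseries a (y - x) (f y).

Definition k1 (L : R) (theta : R -> R) (s : R) : R :=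
  Derive theta s + sin (theta s) / L.
Definition k2 (L : R) (theta : R -> R) (s : R) : R := sin (theta s) / L.
Definition meanH (L : R) (theta : R -> R) (s : R) : R :=
  Derive theta s / 2 + sin (theta s) / L.
Definition wfun (L : R) (theta : R -> R) (s : R) : R :=
  - Derive (meanH L theta) s / k1 L theta s.

(* The equation involves the derivatives of theta up to order three. *)
Definition theta_solution (L : R) (J : R -> Prop) (theta : R -> R) : Prop :=
  forall s, J s ->
    (forall n, (n <= 3)%nat -> ex_derive_n theta n s) /\
    k1 L theta s <> 0 /\
    Derive (wfun L theta) s + wfun L theta s ^ 2
      + cos (theta s) / L * wfun L theta s
      - k1 L theta s ^ 2 - sin (theta s) ^ 2 / L ^ 2 - 2 / L ^ 2 = 0.

Definition Z_solution (L Z0 : R) (J : R -> Prop) (theta Z : R -> R) : Prop :=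
  Z 0 = Z0 /\
  forall s, J s -> is_derive Z s (cos (theta s) / L * Z s + sin (theta s)).

Definition rho (L rho0 : R) (theta : R -> R) (s : R) : R :=
  rho0 * exp (1 / L * RInt (fun x => cos (theta x)) 0 s).

Definition surf (L rho0 : R) (theta Z : R -> R) (s t : R) : vec4 :=
  let r := rho L rho0 theta s in
  let V := (L ^ 2 + Z s ^ 2) / (2 * r) in
  mkvec4 r (V - / 2 * t ^ 2 * r) (t * r) (Z s).

Definition gsurf (L rho0 : R) (theta : R -> R) : metric := fun i j s t =>
  match i, j with
  | i_s, i_s => 1
  | i_t, i_t => - rho L rho0 theta s ^ 2
  | _, _ => 0
  end.

Definition ufun (L u0 : R) (theta : R -> R) (s : R) : R :=
  u0 * exp (- RInt (fun x => Derive (meanH L theta) x / k1 L theta x) 0 s).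

Definition lambda2 (L u0 : R) (theta : R -> R) (s : R) : R :=
  ufun L u0 theta s / meanH L theta s.

(* Main.v *)
Require Import Defs.
From Stdlib Require Import Reals Lra Lia.
From Coquelicot Require Import Coquelicot.
Open Scope R_scope.

(** Write [H^2] for the hyperbolic plane of the points of [AdS_3] with [Y = 0].
    Its horocycles [U = const] have an orthonormal frame (normal, tangent), in
    which the profile curve [(rho, V, 0, Z)] has the velocity
    [(cos theta, sin theta)]: this is what the equations for [rho] and [Z] say.
    The isometries [Pt t] carry the curve and this frame along, so that
    [(cos, sin)] becomes [X_s] and [(- sin, cos)] becomes a unit normal [xi],
    while [X_t] is the Killing field, of square [- rho^2] ([profile_vec],
    [orbit_vec]).  The frame rotates with speed [sin theta / L] along the curve,
    whence [k1 = theta' + sin theta / L] and [k2 = sin theta / L]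
    ([surf_shape_operator]).

    In dimension two the tension field and the rough Laplacian of a conformal
    metric are [lambda^2] times those of the induced metric, since the
    derivatives of the conformal factor cancel in the trace
    ([metric_trace_conformal_warped]).  So the tension field of
    [lambda^{-2} g] is [lambda^2 2 H xi = 2 u xi] ([surf_tension]), and with
    constant curvature [- 1 / L^2] the bitension field is [2 lambda^2] times
    [Delta (u xi) - (2 / L^2) u xi].  Its component along [X_s] is
    [- 2 (u H' + u' k1)], by the Codazzi equation
    [k2' = (cos theta / L) (k1 - k2)], and vanishes by the choice of [u], that is
    [u' = w u].  Its component along [xi] is [u] times
    [w' + w^2 + (cos theta / L) w - k1^2 - k2^2 - 2 / L^2], which is the equation
    for [theta] ([surf_biharmonic]).

    Both operators are computed in the coordinates [(s, t)], but biharmonicity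
    refers to every pseudo-orthonormal frame: [rough_laplacian_trace] and
    [ortho_frame_complete] make the passage.  Smoothness of the surface comes
    from bootstrapping the equation for [theta] as a first-order system for
    [(theta, theta', w)] ([theta_bootstrap]). *)

(** * Linear algebra and differential calculus in R^{2,2} *)

Lemma vec4_eq x y :
  cU x = cU y -> cV x = cV y -> cY x = cY y -> cZ x = cZ y -> x = y.
Proof. destruct x, y; simpl; congruence. Qed.

Lemma cU_add x y : cU (vadd x y) = cU x + cU y.
Proof. reflexivity. Qed.
Lemma cU_sub x y : cU (vsub x y) = cU x - cU y.
Proof. unfold vsub, vadd, vscal; simpl; ring. Qed.
Lemma cU_scal a x : cU (vscal a x) = a * cU x.
Proof. reflexivity. Qed.
Lemma cU_zero : cU vzero = 0.
Proof. reflexivity. Qed.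

Lemma cV_add x y : cV (vadd x y) = cV x + cV y.
Proof. reflexivity. Qed.
Lemma cV_sub x y : cV (vsub x y) = cV x - cV y.
Proof. unfold vsub, vadd, vscal; simpl; ring. Qed.
Lemma cV_scal a x : cV (vscal a x) = a * cV x.
Proof. reflexivity. Qed.
Lemma cV_zero : cV vzero = 0.
Proof. reflexivity. Qed.

Lemma cY_add x y : cY (vadd x y) = cY x + cY y.
Proof. reflexivity. Qed.
Lemma cY_sub x y : cY (vsub x y) = cY x - cY y.
Proof. unfold vsub, vadd, vscal; simpl; ring. Qed.
Lemma cY_scal a x : cY (vscal a x) = a * cY x.
Proof. reflexivity. Qed.
Lemma cY_zero : cY vzero = 0.
Proof. reflexivity. Qed.

Lemma cZ_add x y : cZ (vadd x y) = cZ x + cZ y.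
Proof. reflexivity. Qed.
Lemma cZ_sub x y : cZ (vsub x y) = cZ x - cZ y.
Proof. unfold vsub, vadd, vscal; simpl; ring. Qed.
Lemma cZ_scal a x : cZ (vscal a x) = a * cZ x.
Proof. reflexivity. Qed.
Lemma cZ_zero : cZ vzero = 0.
Proof. reflexivity. Qed.

Hint Rewrite cU_add cU_sub cU_scal cU_zero cV_add cV_sub cV_scal cV_zero
  cY_add cY_sub cY_scal cY_zero cZ_add cZ_sub cZ_scal cZ_zero : coords.

Ltac vec4_components := apply vec4_eq; autorewrite with coords; cbn [cU cV cY cZ].

Ltac vec4_ring := intros; vec4_components; ring.

Lemma ip_sym x y : ip x y = ip y x.
Proof. unfold ip; ring. Qed.

Lemma ip_add_l x y z : ip (vadd x y) z = ip x z + ip y z.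
Proof. unfold ip, vadd; simpl; ring. Qed.

Lemma ip_add_r x y z : ip x (vadd y z) = ip x y + ip x z.
Proof. unfold ip, vadd; simpl; ring. Qed.

Lemma ip_scal_l a x y : ip (vscal a x) y = a * ip x y.
Proof. unfold ip, vscal; simpl; ring. Qed.

Lemma ip_scal_r a x y : ip x (vscal a y) = a * ip x y.
Proof. unfold ip, vscal; simpl; ring. Qed.

Lemma ip_sub_l x y z : ip (vsub x y) z = ip x z - ip y z.
Proof. unfold vsub; rewrite ip_add_l, ip_scal_l; ring. Qed.

Hint Rewrite ip_add_l ip_add_r ip_scal_l ip_scal_r ip_sub_l : ip_lin.

Lemma vadd_zero x : vadd x vzero = x.
Proof. vec4_ring. Qed.

Lemma vscal_zero a : vscal a vzero = vzero.
Proof. vec4_ring. Qed.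

Lemma projT_add L p v w :
  projT L p (vadd v w) = vadd (projT L p v) (projT L p w).
Proof.
unfold projT; rewrite ip_add_l; unfold Rdiv; vec4_ring.
Qed.

Lemma projT_scal L p a v : projT L p (vscal a v) = vscal a (projT L p v).
Proof. unfold projT; rewrite ip_scal_l; unfold Rdiv; vec4_ring. Qed.

Lemma projT_tangent L p v : ip v p = 0 -> projT L p v = v.
Proof. intros H; unfold projT; rewrite H; unfold Rdiv; vec4_ring. Qed.

Lemma projT_normal L p : L <> 0 -> AdS3 L p -> projT L p p = vzero.
Proof.
intros HL Hp; unfold projT; rewrite Hp.
vec4_components; field; exact HL.
Qed.

Lemma ip_projT L p v : L <> 0 -> AdS3 L p -> ip (projT L p v) p = 0.
Proof.
intros HL Hp; unfold projT; rewrite ip_add_l, ip_scal_l, Hp; field; exact HL.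
Qed.

Lemma projT_idem L p v :
  L <> 0 -> AdS3 L p -> projT L p (projT L p v) = projT L p v.
Proof. intros; apply projT_tangent, ip_projT; assumption. Qed.

(** ** Real derivatives, with real instead of abstract operations *)

Lemma is_derive_eq (f : R -> R) (x a b : R) :
  is_derive f x a -> a = b -> is_derive f x b.
Proof. intros H <-; exact H. Qed.

Lemma is_derive_constR (a x : R) : is_derive (fun _ : R => a) x 0.
Proof. exact (is_derive_const a x). Qed.

Lemma is_derive_addR (f g : R -> R) (x df dg : R) :
  is_derive f x df -> is_derive g x dg ->
  is_derive (fun y => f y + g y) x (df + dg).
Proof. intros Hf Hg; exact (is_derive_plus f g x df dg Hf Hg). Qed.

Lemma is_derive_oppR (f : R -> R) (x df : R) :
  is_derive f x df -> is_derive (fun y => - f y) x (- df).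
Proof. intros Hf; exact (is_derive_opp f x df Hf). Qed.

Lemma is_derive_mulR (f g : R -> R) (x df dg : R) :
  is_derive f x df -> is_derive g x dg ->
  is_derive (fun y => f y * g y) x (df * g x + f x * dg).
Proof.
intros Hf Hg; exact (is_derive_mult f g x df dg Hf Hg Rmult_comm).
Qed.

Definition is_derive4 (c : R -> vec4) (x : R) (v : vec4) : Prop :=
  is_derive (fun h => cU (c h)) x (cU v) /\
  is_derive (fun h => cV (c h)) x (cV v) /\
  is_derive (fun h => cY (c h)) x (cY v) /\
  is_derive (fun h => cZ (c h)) x (cZ v).

Lemma is_derive4_eq c x v w : is_derive4 c x v -> v = w -> is_derive4 c x w.
Proof. intros H <-; exact H. Qed.

Lemma is_derive4_ext_loc c d x v :
  locally x (fun y => c y = d y) -> is_derive4 c x v -> is_derive4 d x v.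
Proof.
intros E (H1 & H2 & H3 & H4); refine (conj _ (conj _ (conj _ _)));
  (eapply is_derive_ext_loc; [| eassumption]);
  apply filter_imp with (2 := E); intros y Hy; simpl; rewrite Hy; reflexivity.
Qed.

Lemma is_derive4_const v x : is_derive4 (fun _ => v) x vzero.
Proof. refine (conj _ (conj _ (conj _ _))); apply is_derive_constR. Qed.

Lemma is_derive4_add c d x v w :
  is_derive4 c x v -> is_derive4 d x w ->
  is_derive4 (fun y => vadd (c y) (d y)) x (vadd v w).
Proof.
intros (A1 & A2 & A3 & A4) (B1 & B2 & B3 & B4);
  refine (conj _ (conj _ (conj _ _))); simpl; apply is_derive_addR; assumption.
Qed.

Lemma is_derive4_scal f c x df v :
  is_derive f x df -> is_derive4 c x v ->
  is_derive4 (fun y => vscal (f y) (c y)) x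
    (vadd (vscal df (c x)) (vscal (f x) v)).
Proof.
intros Hf (B1 & B2 & B3 & B4);
  refine (conj _ (conj _ (conj _ _))); simpl; apply is_derive_mulR; assumption.
Qed.

Lemma is_derive_ip c d x v w :
  is_derive4 c x v -> is_derive4 d x w ->
  is_derive (fun y => ip (c y) (d y)) x (ip v (d x) + ip (c x) w).
Proof.
intros (A1 & A2 & A3 & A4) (B1 & B2 & B3 & B4).
assert (HU := is_derive_mulR _ _ _ _ _ A1 B2).
assert (HV := is_derive_mulR _ _ _ _ _ A2 B1).
assert (HY := is_derive_mulR _ _ _ _ _ A3 B3).
assert (HZ := is_derive_mulR _ _ _ _ _ A4 B4).
unfold ip; eapply is_derive_eq.
- apply is_derive_addR; [| exact HZ].
  apply is_derive_addR; [| apply is_derive_oppR; exact HY].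
  apply is_derive_oppR, is_derive_addR; [exact HU | exact HV].
- cbv beta; ring.
Qed.

Lemma is_derive4_projT L p w x dp dw :
  is_derive4 p x dp -> is_derive4 w x dw ->
  is_derive4 (fun y => projT L (p y) (w y)) x
    (vadd (projT L (p x) dw)
       (vadd (vscal (ip (w x) dp / L ^ 2) (p x))
             (vscal (ip (w x) (p x) / L ^ 2) dp))).
Proof.
intros Hp Hw.
eapply is_derive4_eq.
- unfold projT; apply is_derive4_add; [exact Hw |].
  apply is_derive4_scal; [| exact Hp].
  unfold Rdiv; apply is_derive_mulR; [apply is_derive_ip; eassumption |].
  apply is_derive_constR.
- unfold projT, zero; simpl; unfold Rdiv; vec4_ring.
Qed.

Lemma dirD_unique F p v w :
  is_derive4 (fun h => F (vadd p (vscal h v))) 0 w -> dirD F p v = w.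
Proof.
intros (H1 & H2 & H3 & H4).
apply vec4_eq; apply is_derive_unique; assumption.
Qed.

Lemma is_derive4_line p v : is_derive4 (fun h => vadd p (vscal h v)) 0 v.
Proof.
eapply is_derive4_eq.
- apply is_derive4_add; [apply is_derive4_const |].
  apply is_derive4_scal; [exact (is_derive_id 0) | apply is_derive4_const].
- unfold one; simpl; vec4_ring.
Qed.

Lemma line_0 p v : vadd p (vscal 0 v) = p.
Proof. vec4_ring. Qed.

(** * The curvature tensor of AdS_3 *)

Lemma dirD_projT L y q v :
  dirD (fun q => projT L q y) q v =
  vadd (vscal (ip y v / L ^ 2) q) (vscal (ip y q / L ^ 2) v).
Proof.
apply dirD_unique; eapply is_derive4_eq.
- apply is_derive4_projT; [apply is_derive4_line | apply is_derive4_const].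
- cbv beta; rewrite line_0; unfold projT.
  replace (ip vzero q) with 0 by (unfold ip; simpl; ring).
  unfold Rdiv; vec4_ring.
Qed.

(** The projected constant fields are conformal gradient fields: their covariant
    derivative at [p] in tangent directions vanishes, and only the
    second-order term [<z,x> y / L^2] survives. *)
Lemma nablaN_nablaN_projT L p x y z :
  L <> 0 -> AdS3 L p -> ip x p = 0 -> ip y p = 0 -> ip z p = 0 ->
  nablaN L (fun q => projT L q x)
    (nablaN L (fun q => projT L q y) (fun q => projT L q z)) p =
  vscal (ip z x / L ^ 2) y.
Proof.
intros HL Hp Hx Hy Hz.
unfold nablaN at 1; rewrite (projT_tangent L p x Hx).
erewrite dirD_unique.
2:{ set (q h := vadd p (vscal h x)).
  apply is_derive4_ext_loc with (c := fun h => projT L (q h)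
    (vadd (vscal (ip z (projT L (q h) y) / L ^ 2) (q h))
          (vscal (ip z (q h) / L ^ 2) (projT L (q h) y)))).
  - apply filter_forall; intros h; unfold nablaN; rewrite dirD_projT.
    reflexivity.
  - apply is_derive4_projT; [apply is_derive4_line |].
    apply is_derive4_add; apply is_derive4_scal.
    + unfold Rdiv; apply is_derive_mulR; [| apply is_derive_constR].
      apply is_derive_ip; [apply is_derive4_const |].
      apply is_derive4_projT; [apply is_derive4_line | apply is_derive4_const].
    + apply is_derive4_line.
    + unfold Rdiv; apply is_derive_mulR; [| apply is_derive_constR].
      apply is_derive_ip; [apply is_derive4_const | apply is_derive4_line].
    + apply is_derive4_projT; [apply is_derive4_line | apply is_derive4_const]. }
cbv beta; rewrite !line_0, !(projT_tangent L p y Hy).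
unfold projT; autorewrite with ip_lin.
rewrite ?(ip_sym p x), ?(ip_sym p y), ?(ip_sym p z), ?(ip_sym y x),
  ?(ip_sym z x), ?(ip_sym z y), Hp, Hx, Hy, Hz.
assert (Z0 : forall v, ip vzero v = 0) by (intros; unfold ip; simpl; ring).
rewrite (ip_sym z vzero), !Z0; unfold Rdiv.
assert (HK : forall a, a * / L ^ 2 * - L ^ 2 * / L ^ 2 = - (a * / L ^ 2))
  by (intros; field; exact HL).
repeat rewrite ?Rmult_0_l, ?Rmult_0_r, ?Rplus_0_l, ?Rplus_0_r.
rewrite !HK; generalize (/ L ^ 2); intros K.
vec4_components; ring.
Qed.

(** The curvature tensor of constant curvature [- 1 / L^2]; the bracket of the
    projected constant fields is zero at [p]. *)
Lemma RN_tangent L p x y z :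
  L <> 0 -> AdS3 L p -> ip x p = 0 -> ip y p = 0 -> ip z p = 0 ->
  RN L p x y z =
  vsub (vscal (ip x z / L ^ 2) y) (vscal (ip y z / L ^ 2) x).
Proof.
intros HL Hp Hx Hy Hz; unfold RN, curvN.
rewrite !nablaN_nablaN_projT by assumption.
unfold nablaN, bracketN; rewrite !dirD_projT.
rewrite (projT_tangent L p x Hx), (projT_tangent L p y Hy).
rewrite (ip_sym z x), (ip_sym z y), (ip_sym y x), Hx, Hy, Hz.
replace (vsub (vadd (vscal (ip x y / L ^ 2) p) (vscal (0 / L ^ 2) x))
              (vadd (vscal (ip x y / L ^ 2) p) (vscal (0 / L ^ 2) y)))
  with vzero by (unfold Rdiv; vec4_ring).
unfold projT; autorewrite with ip_lin.
replace (ip vzero p) with 0 by (unfold ip; simpl; ring).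
replace (ip z vzero) with 0 by (unfold ip; simpl; ring).
unfold Rdiv; vec4_ring.
Qed.

(** * Smooth functions of one variable *)

(** Being [n] times differentiable on a set, with one derivative peeled off at a
    time: the form in which solutions of differential equations can be
    bootstrapped. *)
Fixpoint diff_n (D : R -> Prop) (n : nat) (f : R -> R) : Prop :=
  match n with
  | O => forall x, D x -> continuous f x
  | S m => (forall x, D x -> ex_derive f x) /\ diff_n D m (Derive f)
  end.

Definition smooth1 (D : R -> Prop) (f : R -> R) : Prop :=
  forall n, diff_n D n f.

Lemma diff_n_ext D n f g :
  open D -> (forall x, D x -> f x = g x) -> diff_n D n f -> diff_n D n g.
Proof.
intros HD; revert f g; induction n as [| n IH]; intros f g E Hf.
- intros x Hx; apply continuous_ext_loc with f; [| exact (Hf x Hx)].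
  apply filter_imp with (2 := HD x Hx); exact E.
- destruct Hf as [H1 H2]; split.
  + intros x Hx; apply ex_derive_ext_loc with f; [| exact (H1 x Hx)].
    apply filter_imp with (2 := HD x Hx); exact E.
  + apply IH with (Derive f); [| exact H2].
    intros x Hx; apply Derive_ext_loc.
    apply filter_imp with (2 := HD x Hx); exact E.
Qed.

Lemma diff_n_step D n f f' :
  open D -> (forall x, D x -> is_derive f x (f' x)) -> diff_n D n f' ->
  diff_n D (S n) f.
Proof.
intros HD H H'; split.
- intros x Hx; exists (f' x); exact (H x Hx).
- apply diff_n_ext with f'; [exact HD | | exact H'].
  intros x Hx; symmetry; apply is_derive_unique, H, Hx.
Qed.

Lemma diff_n_S D n f : diff_n D (S n) f -> diff_n D n f.
Proof.
revert f; induction n as [| n IH]; intros f [H1 H2].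
- intros x Hx; apply (ex_derive_continuous f x (H1 x Hx)).
- split; [exact H1 | exact (IH _ H2)].
Qed.

Lemma diff_n_const D n a : open D -> diff_n D n (fun _ => a).
Proof.
intros HD; revert a; induction n as [| n IH]; intros a.
- intros x _; apply continuous_const.
- apply diff_n_step with (fun _ => 0);
    [exact HD | intros; apply is_derive_constR | apply IH].
Qed.

Lemma diff_n_id D n : open D -> diff_n D n (fun x => x).
Proof.
intros HD; destruct n as [| n].
- intros x _; apply continuous_id.
- apply diff_n_step with (fun _ => 1);
    [exact HD | intros; exact (is_derive_id x) | apply diff_n_const, HD].
Qed.

Lemma diff_n_add D n f g :
  open D -> diff_n D n f -> diff_n D n g -> diff_n D n (fun x => f x + g x).
Proof.
intros HD; revert f g; induction n as [| n IH]; intros f g Hf Hg.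
- intros x Hx; exact (continuous_plus f g x (Hf x Hx) (Hg x Hx)).
- destruct Hf as [F1 F2], Hg as [G1 G2].
  apply diff_n_step with (2 := fun x Hx => is_derive_addR f g x _ _
    (Derive_correct _ _ (F1 x Hx)) (Derive_correct _ _ (G1 x Hx)));
    [exact HD | apply IH; assumption].
Qed.

Lemma diff_n_mul D n f g :
  open D -> diff_n D n f -> diff_n D n g -> diff_n D n (fun x => f x * g x).
Proof.
intros HD; revert f g; induction n as [| n IH]; intros f g Hf Hg.
- intros x Hx; exact (continuous_mult f g x (Hf x Hx) (Hg x Hx)).
- assert (F := diff_n_S _ _ _ Hf); assert (G := diff_n_S _ _ _ Hg).
  destruct Hf as [F1 F2], Hg as [G1 G2].
  apply diff_n_step with (2 := fun x Hx => is_derive_mulR f g x _ _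
    (Derive_correct _ _ (F1 x Hx)) (Derive_correct _ _ (G1 x Hx)));
    [exact HD | apply diff_n_add; [exact HD | |]; apply IH; assumption].
Qed.

Lemma is_derive_compR (f g : R -> R) (x df dg : R) :
  is_derive f (g x) df -> is_derive g x dg ->
  is_derive (fun y => f (g y)) x (df * dg).
Proof.
intros Hf Hg; apply is_derive_eq with (1 := is_derive_comp f g x df dg Hf Hg).
apply Rmult_comm.
Qed.

Lemma diff_n_sin_cos D n f :
  open D -> diff_n D n f ->
  diff_n D n (fun x => sin (f x)) /\ diff_n D n (fun x => cos (f x)).
Proof.
intros HD; induction n as [| n IH]; intros Hf.
- split; intros x Hx.
  + apply (continuous_comp f sin); [exact (Hf x Hx) | apply continuous_sin].
  + apply (continuous_comp f cos); [exact (Hf x Hx) | apply continuous_cos].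
- destruct (IH (diff_n_S _ _ _ Hf)) as [IHs IHc]; destruct Hf as [F1 F2].
  split.
  + apply diff_n_step with (2 := fun x Hx => is_derive_compR sin f x _ _
      (is_derive_sin (f x)) (Derive_correct _ _ (F1 x Hx)));
      [exact HD | apply diff_n_mul; assumption].
  + apply diff_n_step with (fun x => -1 * sin (f x) * Derive f x);
      [exact HD | |].
    * intros x Hx; apply is_derive_eq with (1 := is_derive_compR cos f x _ _
        (is_derive_cos (f x)) (Derive_correct _ _ (F1 x Hx))); ring.
    * repeat apply diff_n_mul; try assumption; apply diff_n_const, HD.
Qed.

Lemma diff_n_inv D n f :
  open D -> (forall x, D x -> f x <> 0) -> diff_n D n f ->
  diff_n D n (fun x => / f x).
Proof.
intros HD H0; induction n as [| n IH]; intros Hf.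
- intros x Hx; apply continuous_Rinv_comp; [exact (Hf x Hx) | exact (H0 x Hx)].
- assert (IH' := IH (diff_n_S _ _ _ Hf)); destruct Hf as [F1 F2].
  apply diff_n_step with (fun x => -1 * (Derive f x * (/ f x * / f x)));
    [exact HD | |].
  + intros x Hx; apply is_derive_eq with (1 := is_derive_inv f x _
      (Derive_correct _ _ (F1 x Hx)) (H0 x Hx)); field; exact (H0 x Hx).
  + repeat apply diff_n_mul; try assumption; apply diff_n_const, HD.
Qed.

Lemma smooth1_const D a : open D -> smooth1 D (fun _ => a).
Proof. intros HD n; apply diff_n_const, HD. Qed.

Lemma smooth1_id D : open D -> smooth1 D (fun x => x).
Proof. intros HD n; apply diff_n_id, HD. Qed.

Lemma smooth1_add D f g :
  open D -> smooth1 D f -> smooth1 D g -> smooth1 D (fun x => f x + g x).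
Proof. intros HD Hf Hg n; apply diff_n_add; auto. Qed.

Lemma smooth1_mul D f g :
  open D -> smooth1 D f -> smooth1 D g -> smooth1 D (fun x => f x * g x).
Proof. intros HD Hf Hg n; apply diff_n_mul; auto. Qed.

Lemma smooth1_opp D f : open D -> smooth1 D f -> smooth1 D (fun x => - f x).
Proof.
intros HD Hf n; apply diff_n_ext with (fun x => -1 * f x);
  [exact HD | intros; ring | apply diff_n_mul; auto using diff_n_const].
Qed.

Lemma smooth1_sub D f g :
  open D -> smooth1 D f -> smooth1 D g -> smooth1 D (fun x => f x - g x).
Proof. intros HD Hf Hg; apply smooth1_add; auto using smooth1_opp. Qed.

Lemma smooth1_pow D f k :
  open D -> smooth1 D f -> smooth1 D (fun x => f x ^ k).
Proof.
intros HD Hf; induction k as [| k IH]; simpl;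
  [apply smooth1_const | apply smooth1_mul]; assumption.
Qed.

Lemma smooth1_inv D f :
  open D -> (forall x, D x -> f x <> 0) -> smooth1 D f ->
  smooth1 D (fun x => / f x).
Proof. intros HD H0 Hf n; apply diff_n_inv; auto. Qed.

Lemma smooth1_sin D f : open D -> smooth1 D f -> smooth1 D (fun x => sin (f x)).
Proof. intros HD Hf n; apply (diff_n_sin_cos D n f HD (Hf n)). Qed.

Lemma smooth1_cos D f : open D -> smooth1 D f -> smooth1 D (fun x => cos (f x)).
Proof. intros HD Hf n; apply (diff_n_sin_cos D n f HD (Hf n)). Qed.

Lemma smooth1_continuous D f x : smooth1 D f -> D x -> continuous f x.
Proof. intros Hf; exact (Hf O x). Qed.

Lemma smooth1_is_derive D f x :
  smooth1 D f -> D x -> is_derive f x (Derive f x).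
Proof. intros Hf Hx; apply Derive_correct, (Hf 1%nat), Hx. Qed.

Lemma smooth1_Derive D f : smooth1 D f -> smooth1 D (Derive f).
Proof. intros Hf n; exact (proj2 (Hf (S n))). Qed.

Ltac smooth1_tac :=
  repeat first
    [ assumption
    | apply smooth1_const | apply smooth1_id
    | apply smooth1_sub | apply smooth1_add | apply smooth1_opp
    | apply smooth1_mul | apply smooth1_pow | apply smooth1_inv
    | apply smooth1_sin | apply smooth1_cos ].

(** Covers [rho], [Z] and [u], which all satisfy linear equations. *)
Lemma smooth1_linear_ode D a b f :
  open D -> smooth1 D a -> smooth1 D b ->
  (forall x, D x -> is_derive f x (a x * f x + b x)) -> smooth1 D f.
Proof.
intros HD Ha Hb Hf n; induction n as [| n IH].
- intros x Hx; apply (ex_derive_continuous f x); eexists; apply Hf, Hx.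
- apply diff_n_step with (2 := Hf); [exact HD |].
  apply diff_n_add; [exact HD | apply diff_n_mul; auto | apply Hb].
Qed.

(** * Smooth functions of two variables *)

Lemma open_2d_rect I J : open I -> open J -> open_2d (rect I J).
Proof.
intros HI HJ s t [Hs Ht].
destruct (HI s Hs) as [d1 H1], (HJ t Ht) as [d2 H2].
exists (mkposreal _ (Rmin_stable_in_posreal d1 d2)); simpl.
intros u v Hu Hv; split.
- apply H1; exact (Rlt_le_trans _ _ _ Hu (Rmin_l _ _)).
- apply H2; exact (Rlt_le_trans _ _ _ Hv (Rmin_r _ _)).
Qed.

Lemma smooth_ext Om f g :
  open_2d Om -> (forall s t, Om s t -> f s t = g s t) ->
  smooth Om f -> smooth Om g.
Proof.
intros HO E Hf s t Hst n; apply ex_diff_n_ext_loc with f; [| apply Hf, Hst].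
destruct (HO s t Hst) as [d Hd]; exists d; intros u v Hu Hv.
exact (E u v (Hd u v Hu Hv)).
Qed.

Lemma smooth_add Om f g :
  open_2d Om -> smooth Om f -> smooth Om g ->
  smooth Om (fun s t => f s t + g s t).
Proof.
intros HO Hf Hg s t Hst n.
assert (Hf' : forall s t, Om s t -> ex_diff_n f n s t) by (intros; apply Hf; auto).
assert (Hg' : forall s t, Om s t -> ex_diff_n g n s t) by (intros; apply Hg; auto).
clear Hf Hg; revert f g Hf' Hg' s t Hst.
induction n as [| n IH]; intros f g Hf Hg s t Hst.
- split; [| exact I].
  apply continuity_2d_pt_plus; [apply (Hf s t Hst) | apply (Hg s t Hst)].
- assert (Hf1 := fun s t H => proj2 (Hf s t H)).
  assert (Hg1 := fun s t H => proj2 (Hg s t H)).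
  cbn beta iota in Hf1, Hg1.
  split; [| split; [| split; [| split]]].
  + apply continuity_2d_pt_plus; [apply (Hf s t Hst) | apply (Hg s t Hst)].
  + apply (ex_derive_plus (fun z => f z t) (fun z => g z t));
      [apply (Hf1 s t Hst) | apply (Hg1 s t Hst)].
  + apply (ex_derive_plus (fun z => f s z) (fun z => g s z));
      [apply (Hf1 s t Hst) | apply (Hg1 s t Hst)].
  + apply ex_diff_n_ext_loc with (fun u v =>
      Derive (fun z => f z v) u + Derive (fun z => g z v) u).
    * destruct (HO s t Hst) as [d Hd]; exists d; intros u v Hu Hv.
      symmetry; apply (Derive_plus (fun z => f z v) (fun z => g z v));
        [apply (Hf1 u v) | apply (Hg1 u v)]; auto.
    * apply IH; [intros a b H; apply (Hf1 a b H)
                | intros a b H; apply (Hg1 a b H) | exact Hst].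
  + apply ex_diff_n_ext_loc with (fun u v =>
      Derive (fun z => f u z) v + Derive (fun z => g u z) v).
    * destruct (HO s t Hst) as [d Hd]; exists d; intros u v Hu Hv.
      symmetry; apply (Derive_plus (fun z => f u z) (fun z => g u z));
        [apply (Hf1 u v) | apply (Hg1 u v)]; auto.
    * apply IH; [intros a b H; apply (Hf1 a b H)
                | intros a b H; apply (Hg1 a b H) | exact Hst].
Qed.

Lemma smooth_product I J a b :
  smooth1 I a -> smooth1 J b -> smooth (rect I J) (fun s t => a s * b t).
Proof.
intros Ha Hb s t [Hs Ht] n; revert a b Ha Hb.
induction n as [| n IH]; intros a b Ha Hb.
- split; [| exact Logic.I]; apply continuity_2d_pt_mult.
  + apply (continuity_1d_2d_pt_comp a (fun u _ => u));
      [apply continuity_pt_filterlim, (smooth1_continuous _ _ _ Ha Hs)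
      | apply continuity_2d_pt_id1].
  + apply (continuity_1d_2d_pt_comp b (fun _ v => v));
      [apply continuity_pt_filterlim, (smooth1_continuous _ _ _ Hb Ht)
      | apply continuity_2d_pt_id2].
- split; [destruct n; apply (IH a b Ha Hb) |].
  split; [| split; [| split]].
  + exists (Derive a s * b t + a s * 0).
    apply (is_derive_mulR a (fun _ => b t)); [apply (smooth1_is_derive _ _ _ Ha Hs)
                          | apply is_derive_constR].
  + exists (0 * b t + a s * Derive b t).
    apply (is_derive_mulR (fun _ => a s) b); [apply is_derive_constR
                          | apply (smooth1_is_derive _ _ _ Hb Ht)].
  + apply ex_diff_n_ext_loc with (fun u v => Derive a u * b v).
    * exists (mkposreal 1 Rlt_0_1); intros u v _ _; symmetry.
      apply Derive_scal_l.
    * apply IH; [apply smooth1_Derive, Ha | exact Hb].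
  + apply ex_diff_n_ext_loc with (fun u v => a u * Derive b v).
    * exists (mkposreal 1 Rlt_0_1); intros u v _ _; symmetry.
      apply Derive_scal.
    * apply IH; [exact Ha | apply smooth1_Derive, Hb].
Qed.

(** The shape of the components of fields carried along by the quadratic
    one-parameter group [Pt]. *)
Lemma smooth_quadratic I J a0 a1 a2 :
  open I -> open J -> smooth1 I a0 -> smooth1 I a1 -> smooth1 I a2 ->
  smooth (rect I J) (fun s t => a0 s + a1 s * t + a2 s * t ^ 2).
Proof.
intros HI HJ H0 H1 H2.
assert (HO := open_2d_rect I J HI HJ).
repeat apply smooth_add; try exact HO.
- apply smooth_ext with (fun s t => a0 s * 1); [exact HO | intros; ring |].
  apply (smooth_product I J a0 (fun _ => 1)); smooth1_tac.
- apply (smooth_product I J a1 (fun t => t)); smooth1_tac.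
- apply (smooth_product I J a2 (fun t => t ^ 2)); smooth1_tac.
Qed.

Lemma smooth_of_first I J a :
  open I -> open J -> smooth1 I a -> smooth (rect I J) (fun s _ => a s).
Proof.
intros HI HJ Ha; apply smooth_ext with (fun s t => a s * 1);
  [apply open_2d_rect; assumption | intros; ring |].
apply (smooth_product I J a (fun _ => 1)); smooth1_tac.
Qed.

(** * Regularity of the profile functions *)

Section Profile.

Context (L : R) (I : R -> Prop) (theta : R -> R).
Context (hL : L <> 0) (HI : open I) (Hth : theta_solution L I theta).

Lemma theta_is_derive s : I s -> is_derive theta s (Derive theta s).
Proof.
intros Hs; apply Derive_correct.
exact (proj1 (Hth s Hs) 1%nat ltac:(lia)).
Qed.

Lemma dtheta_ex_derive s : I s -> ex_derive (Derive theta) s.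
Proof. intros Hs; exact (proj1 (Hth s Hs) 2%nat ltac:(lia)). Qed.

Lemma k1_neq0 s : I s -> k1 L theta s <> 0.
Proof. intros Hs; apply (Hth s Hs). Qed.

Lemma sin_theta_is_derive s :
  I s -> is_derive (fun x => sin (theta x)) s (cos (theta s) * Derive theta s).
Proof.
intros Hs; apply (is_derive_compR sin);
  [apply is_derive_sin | apply theta_is_derive, Hs].
Qed.

Lemma cos_theta_is_derive s :
  I s -> is_derive (fun x => cos (theta x)) s (- sin (theta s) * Derive theta s).
Proof.
intros Hs; apply (is_derive_compR cos);
  [apply is_derive_cos | apply theta_is_derive, Hs].
Qed.

Lemma meanH_is_derive s :
  I s -> is_derive (meanH L theta) s
    (Derive (Derive theta) s / 2 + cos (theta s) * Derive theta s / L).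
Proof.
intros Hs; unfold meanH, Rdiv; eapply is_derive_eq.
- apply is_derive_addR; apply is_derive_mulR;
    [apply Derive_correct, dtheta_ex_derive, Hs | apply is_derive_constR
    | apply sin_theta_is_derive, Hs | apply is_derive_constR].
- cbv beta; ring.
Qed.

Lemma wfun_eq s :
  I s -> wfun L theta s =
    - (Derive (Derive theta) s / 2 + cos (theta s) * Derive theta s / L)
    / k1 L theta s.
Proof.
intros Hs; unfold wfun.
rewrite (is_derive_unique _ _ _ (meanH_is_derive s Hs)); reflexivity.
Qed.

(** The definition of [w], solved for [theta'']. *)
Lemma dtheta_is_derive s :
  I s -> is_derive (Derive theta) s
    (- 2 * wfun L theta s * k1 L theta s
     - 2 * Derive theta s * (cos (theta s) / L)).
Proof.
intros Hs; apply is_derive_eq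
  with (1 := Derive_correct _ _ (dtheta_ex_derive s Hs)).
rewrite wfun_eq by exact Hs; field; split; [exact hL | exact (k1_neq0 s Hs)].
Qed.

(** [w] contains the third derivative of [theta] only after one further
    differentiation, so that the equation says that [(theta, theta', w)] is a
    solution of a first-order system with polynomial right-hand side in these
    functions and [sin theta], [cos theta]. *)
Lemma wfun_is_derive s :
  I s -> is_derive (wfun L theta) s
    (- wfun L theta s ^ 2 - cos (theta s) / L * wfun L theta s
     + k1 L theta s ^ 2 + sin (theta s) ^ 2 / L ^ 2 + 2 / L ^ 2).
Proof.
intros Hs.
assert (Hex : ex_derive (wfun L theta) s).
{ apply ex_derive_ext_loc with (fun x =>
    - (Derive (Derive theta) x / 2 + cos (theta x) * Derive theta x / L)
    / k1 L theta x).
  - apply filter_imp with (2 := HI s Hs).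
    intros x Hx; symmetry; apply wfun_eq, Hx.
  - assert (H3 : ex_derive (fun x => Derive (Derive theta) x) s)
      by exact (proj1 (Hth s Hs) 3%nat ltac:(lia)).
    assert (H2 := dtheta_ex_derive s Hs).
    assert (H1 : ex_derive theta s) by (eexists; exact (theta_is_derive s Hs)).
    assert (H0 := k1_neq0 s Hs); unfold k1 in H0 |- *.
    auto_derive; repeat split; assumption. }
apply is_derive_eq with (1 := Derive_correct _ _ Hex).
destruct (Hth s Hs) as (_ & _ & E); lra.
Qed.

Lemma theta_bootstrap n :
  diff_n I n theta /\ diff_n I n (Derive theta) /\ diff_n I n (wfun L theta).
Proof.
induction n as [| n (H1 & H2 & H3)].
- split; [| split]; intros s Hs.
  + apply (ex_derive_continuous theta); eexists; apply theta_is_derive, Hs.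
  + apply (ex_derive_continuous (Derive theta)); eexists;
      apply dtheta_is_derive, Hs.
  + apply (ex_derive_continuous (wfun L theta)); eexists;
      apply wfun_is_derive, Hs.
- assert (Hsc := diff_n_sin_cos I n theta HI H1); destruct Hsc as [Hsin Hcos].
  split; [| split].
  + apply diff_n_step with (2 := theta_is_derive); assumption.
  + apply diff_n_step with (2 := dtheta_is_derive); [exact HI |].
    unfold k1, Rdiv, Rminus.
    apply diff_n_ext with (fun x =>
      -2 * wfun L theta x * (Derive theta x + sin (theta x) * / L)
      + -2 * Derive theta x * (cos (theta x) * / L)); [exact HI | intros; ring |].
    repeat first [assumption | apply diff_n_const | apply diff_n_add
      | apply diff_n_mul].
  + apply diff_n_step with (2 := wfun_is_derive); [exact HI |].
    apply diff_n_ext with (fun x =>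
      -1 * wfun L theta x * wfun L theta x
      + -1 * (cos (theta x) * / L) * wfun L theta x
      + (Derive theta x + sin (theta x) * / L)
        * (Derive theta x + sin (theta x) * / L)
      + sin (theta x) * sin (theta x) * / L ^ 2 + 2 * / L ^ 2);
      [exact HI | intros; unfold k1, Rdiv; ring |].
    repeat first [assumption | apply diff_n_const | apply diff_n_add
      | apply diff_n_mul].
Qed.

Lemma smooth1_theta : smooth1 I theta.
Proof. intros n; apply theta_bootstrap. Qed.

Lemma smooth1_dtheta : smooth1 I (Derive theta).
Proof. intros n; apply theta_bootstrap. Qed.

Lemma smooth1_wfun : smooth1 I (wfun L theta).
Proof. intros n; apply theta_bootstrap. Qed.

Lemma smooth1_cos_theta : smooth1 I (fun s => cos (theta s)).
Proof. apply smooth1_cos; [exact HI | exact smooth1_theta]. Qed.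

Lemma smooth1_sin_theta : smooth1 I (fun s => sin (theta s)).
Proof. apply smooth1_sin; [exact HI | exact smooth1_theta]. Qed.

Lemma smooth1_meanH : smooth1 I (meanH L theta).
Proof.
assert (H := smooth1_dtheta); assert (H' := smooth1_sin_theta).
unfold meanH, Rdiv; smooth1_tac.
Qed.

Lemma k1_is_derive s :
  I s -> is_derive (k1 L theta) s
    (- 2 * wfun L theta s * k1 L theta s
     - 2 * Derive theta s * (cos (theta s) / L)
     + cos (theta s) * Derive theta s / L).
Proof.
intros Hs; unfold k1 at 1, Rdiv; eapply is_derive_eq.
- apply is_derive_addR; [exact (dtheta_is_derive s Hs) | apply is_derive_mulR];
    [apply sin_theta_is_derive, Hs | apply is_derive_constR].
- cbv beta; unfold Rdiv; ring.
Qed.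

End Profile.

Lemma is_derive_RInt_interval I (f : R -> R) (s : R) :
  is_open_interval I -> I 0 -> (forall x, I x -> continuous f x) -> I s ->
  is_derive (fun x => RInt f 0 x) s (f s).
Proof.
intros (HO & _ & HC) H0 Hf Hs.
apply is_derive_RInt with 0; [| exact (Hf s Hs)].
apply filter_imp with (2 := HO s Hs); intros x Hx.
apply RInt_correct, (ex_RInt_continuous (V := R_CompleteNormedModule)).
intros z Hz; apply Hf.
unfold Rmin, Rmax in Hz; destruct (Rle_dec 0 x).
- apply HC with 0 x; assumption.
- apply HC with x 0; assumption.
Qed.

Lemma is_derive_exp_RInt I (a k : R) (f : R -> R) (s : R) :
  is_open_interval I -> I 0 -> (forall x, I x -> continuous f x) -> I s ->
  is_derive (fun x => a * exp (k * RInt f 0 x)) s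
    (k * f s * (a * exp (k * RInt f 0 s))).
Proof.
intros HI H0 Hf Hs; eapply is_derive_eq.
- apply is_derive_mulR; [apply is_derive_constR |].
  apply (is_derive_compR exp); [apply is_derive_exp |].
  apply is_derive_mulR; [apply is_derive_constR |].
  apply (is_derive_RInt_interval I); assumption.
- cbv beta; ring.
Qed.

Section ProfileIntegrals.

Context (L : R) (I : R -> Prop) (theta : R -> R).
Context (hL : L <> 0) (HI : is_open_interval I) (H0 : I 0).
Context (Hth : theta_solution L I theta).

Let HO : open I := proj1 HI.

Lemma rho_is_derive rho0 s :
  I s -> is_derive (rho L rho0 theta) s (cos (theta s) / L * rho L rho0 theta s).
Proof.
intros Hs; eapply is_derive_eq.
- apply (is_derive_exp_RInt I rho0 (1 / L)); try assumption.
  intros x; apply smooth1_continuous; apply (smooth1_cos_theta L); assumption.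
- unfold rho; unfold Rdiv; ring.
Qed.

Lemma smooth1_rho rho0 : smooth1 I (rho L rho0 theta).
Proof.
assert (HC := smooth1_cos_theta L I theta hL HO Hth).
apply (smooth1_linear_ode I (fun s => cos (theta s) / L) (fun _ => 0));
  try smooth1_tac.
intros s Hs; eapply is_derive_eq; [exact (rho_is_derive rho0 s Hs) | ring].
Qed.

Lemma ufun_is_derive u0 s :
  I s -> is_derive (ufun L u0 theta) s (wfun L theta s * ufun L u0 theta s).
Proof.
intros Hs.
assert (E : forall y : R,
  - wfun L theta y = Derive (meanH L theta) y / k1 L theta y)
  by (intros y; unfold wfun, Rdiv; ring).
apply is_derive_ext_loc with (fun x =>
  u0 * exp (-1 * RInt (fun x => Derive (meanH L theta) x / k1 L theta x) 0 x)).
{ apply filter_forall; intros x; unfold ufun.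
  apply (f_equal (fun y => u0 * exp y)).
  generalize (RInt (fun x => Derive (meanH L theta) x / k1 L theta x) 0 x).
  intros r; simpl in r; ring. }
eapply is_derive_eq.
- apply (is_derive_exp_RInt I u0 (-1)); try assumption.
  intros x Hx; apply continuous_ext with (fun y => - wfun L theta y).
  + exact E.
  + apply (continuous_opp (wfun L theta)).
    apply smooth1_continuous with I; [apply smooth1_wfun | ]; assumption.
- unfold ufun, wfun.
  replace (-1 * RInt (fun x => Derive (meanH L theta) x / k1 L theta x) 0 s)
    with (- RInt (fun x => Derive (meanH L theta) x / k1 L theta x) 0 s) by ring.
  unfold Rdiv; ring.
Qed.

Lemma smooth1_ufun u0 : smooth1 I (ufun L u0 theta).
Proof.
assert (HW := smooth1_wfun L I theta hL HO Hth).
apply (smooth1_linear_ode I (wfun L theta) (fun _ => 0)); try smooth1_tac.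
intros s Hs; eapply is_derive_eq; [exact (ufun_is_derive u0 s Hs) | ring].
Qed.

Lemma smooth1_Z Z0 Z : Z_solution L Z0 I theta Z -> smooth1 I Z.
Proof.
intros [_ HZ].
assert (HC := smooth1_cos_theta L I theta hL HO Hth).
assert (HS := smooth1_sin_theta L I theta hL HO Hth).
apply (smooth1_linear_ode I (fun s => cos (theta s) / L)
  (fun s => sin (theta s))); try smooth1_tac; exact HZ.
Qed.

End ProfileIntegrals.

Lemma rho_pos L rho0 theta s : 0 < rho0 -> 0 < rho L rho0 theta s.
Proof. intros H; apply Rmult_lt_0_compat; [exact H | apply exp_pos]. Qed.

(** * The moving frame of an orbit surface *)

Definition is_pd (i : idx) (f : R -> R -> R) (s t d : R) : Prop :=
  match i with
  | i_s => is_derive (fun x => f x t) s d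
  | i_t => is_derive (fun x => f s x) t d
  end.

Definition is_pd4 (i : idx) (F : R -> R -> vec4) (s t : R) (v : vec4) : Prop :=
  match i with
  | i_s => is_derive4 (fun x => F x t) s v
  | i_t => is_derive4 (fun x => F s x) t v
  end.

Lemma pd_unique i f s t d : is_pd i f s t d -> pd i f s t = d.
Proof. destruct i; apply is_derive_unique. Qed.

Lemma pd4_unique i F s t v : is_pd4 i F s t v -> pd4 i F s t = v.
Proof.
destruct i; intros (H1 & H2 & H3 & H4);
  apply vec4_eq; apply is_derive_unique; assumption.
Qed.

Lemma is_pd4_ext_loc Om i F G s t v :
  open_2d Om -> Om s t -> (forall s t, Om s t -> F s t = G s t) ->
  is_pd4 i F s t v -> is_pd4 i G s t v.
Proof.
intros HO Hst E; assert (HL := HO s t Hst).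
destruct i; simpl; apply is_derive4_ext_loc.
- destruct HL as [d Hd]; exists d; intros x Hx; apply E, Hd; [exact Hx |].
  rewrite Rminus_diag, Rabs_R0; apply cond_pos.
- destruct HL as [d Hd]; exists d; intros x Hx; apply E, Hd; [| exact Hx].
  rewrite Rminus_diag, Rabs_R0; apply cond_pos.
Qed.

Lemma is_pd4_add i F G s t v w :
  is_pd4 i F s t v -> is_pd4 i G s t w ->
  is_pd4 i (fun s t => vadd (F s t) (G s t)) s t (vadd v w).
Proof. destruct i; apply is_derive4_add. Qed.

Lemma is_pd4_scal i f F s t d v :
  is_pd i f s t d -> is_pd4 i F s t v ->
  is_pd4 i (fun s t => vscal (f s t) (F s t)) s t
    (vadd (vscal d (F s t)) (vscal (f s t) v)).
Proof.
destruct i; intros Hf HF;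
  [exact (is_derive4_scal (fun x => f x t) (fun x => F x t) s d v Hf HF)
  | exact (is_derive4_scal (fun x => f s x) (fun x => F s x) t d v Hf HF)].
Qed.

Definition point (L r z t : R) : vec4 :=
  mkvec4 r ((L ^ 2 + z ^ 2) / (2 * r) - / 2 * t ^ 2 * r) (t * r) z.

(** The vector with coordinates [(p, q)] in an orthonormal frame of the profile
    plane [Y = 0, t = 0] of [AdS_3], which is a hyperbolic plane: the first
    frame vector is normal, the second one tangent to the horocycles [r = const].
    Then it is moved by [Pt t]. *)
Definition profile_vec (L r z t p q : R) : vec4 :=
  mkvec4 (p * r / L)
    (p * (z ^ 2 - L ^ 2) / (2 * r * L) + q * z / r - / 2 * t ^ 2 * (p * r / L))
    (t * (p * r / L)) (p * z / L + q).

Definition orbit_vec (r t : R) : vec4 := mkvec4 0 (- t * r) r 0.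

Section FrameProducts.

Context (L r z t : R) (hL : L <> 0) (hr : r <> 0).

Lemma ip_point_point : ip (point L r z t) (point L r z t) = - L ^ 2.
Proof. unfold ip, point; simpl; field; exact hr. Qed.

Lemma ip_profile_point p q :
  ip (profile_vec L r z t p q) (point L r z t) = 0.
Proof.
unfold ip, point, profile_vec; simpl; field; split; assumption.
Qed.

Lemma ip_orbit_point : ip (orbit_vec r t) (point L r z t) = 0.
Proof. unfold ip, point, orbit_vec; simpl; ring. Qed.

Lemma ip_profile_profile p q p' q' :
  ip (profile_vec L r z t p q) (profile_vec L r z t p' q') = p * p' + q * q'.
Proof. unfold ip, profile_vec; simpl; field; split; assumption. Qed.

Lemma ip_profile_orbit p q :
  ip (profile_vec L r z t p q) (orbit_vec r t) = 0.
Proof. unfold ip, profile_vec, orbit_vec; simpl; field; split; assumption. Qed.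

Lemma ip_orbit_orbit : ip (orbit_vec r t) (orbit_vec r t) = - r ^ 2.
Proof. unfold ip, orbit_vec; simpl; ring. Qed.

Lemma profile_vec_add p q p' q' :
  vadd (profile_vec L r z t p q) (profile_vec L r z t p' q') =
  profile_vec L r z t (p + p') (q + q').
Proof.
vec4_components; unfold profile_vec; simpl; field; try split; assumption.
Qed.

Lemma profile_vec_scal a p q :
  vscal a (profile_vec L r z t p q) = profile_vec L r z t (a * p) (a * q).
Proof.
vec4_components; unfold profile_vec; simpl; field; try split; assumption.
Qed.

Lemma profile_vec_0 : profile_vec L r z t 0 0 = vzero.
Proof.
vec4_components; unfold profile_vec; simpl; field; try split; assumption.
Qed.

Lemma point_AdS3 : AdS3 L (point L r z t).
Proof. exact ip_point_point. Qed.

Lemma projT_profile p q :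
  projT L (point L r z t) (profile_vec L r z t p q) = profile_vec L r z t p q.
Proof. apply projT_tangent, ip_profile_point. Qed.

Lemma projT_orbit : projT L (point L r z t) (orbit_vec r t) = orbit_vec r t.
Proof. apply projT_tangent, ip_orbit_point. Qed.

End FrameProducts.

(** ** Derivatives of the frame

    [(c, n)] is the velocity of the profile curve in the frame of [profile_vec];
    the frame rotates with speed [n / L], because only the horocycles, of
    curvature [1 / L], are curved. *)
Section FrameDerivatives.

Context (L s t : R) (r z : R -> R) (c n : R).
Context (hL : L <> 0) (hr : r s <> 0).
Context (Hr : is_derive r s (c / L * r s)).
Context (Hz : is_derive z s (c / L * z s + n)).

Lemma point_pd_s :
  is_derive4 (fun x => point L (r x) (z x) t) s (profile_vec L (r s) (z s) t c n).
Proof.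
assert (Er : ex_derive r s) by (eexists; exact Hr).
assert (Ez : ex_derive z s) by (eexists; exact Hz).
assert (Dr := is_derive_unique r s _ Hr).
assert (Dz := is_derive_unique z s _ Hz).
unfold point, profile_vec; refine (conj _ (conj _ (conj _ _))); simpl;
  auto_derive; auto;
  change (fun x => r x) with r; change (fun x => z x) with z;
  rewrite ?Dr, ?Dz; try (field; auto).
repeat apply conj; auto;
  repeat apply Rmult_integral_contrapositive_currified; auto; lra.
Qed.

Lemma profile_vec_pd_s (p q : R -> R) (dp dq : R) :
  is_derive p s dp -> is_derive q s dq ->
  is_derive4 (fun x => profile_vec L (r x) (z x) t (p x) (q x)) s
    (vadd (profile_vec L (r s) (z s) t (dp - q s * (n / L)) (dq + p s * (n / L)))
          (vscal ((p s * c + q s * n) / L ^ 2) (point L (r s) (z s) t))).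
Proof.
intros Hp Hq.
assert (Er : ex_derive r s) by (eexists; exact Hr).
assert (Ez : ex_derive z s) by (eexists; exact Hz).
assert (Ep : ex_derive p s) by (eexists; exact Hp).
assert (Eq : ex_derive q s) by (eexists; exact Hq).
assert (Dr := is_derive_unique r s _ Hr).
assert (Dz := is_derive_unique z s _ Hz).
assert (Dp := is_derive_unique p s _ Hp).
assert (Dq := is_derive_unique q s _ Hq).
unfold point, profile_vec; refine (conj _ (conj _ (conj _ _))); simpl;
  auto_derive; auto;
  change (fun x => r x) with r; change (fun x => z x) with z;
  change (fun x => p x) with p; change (fun x => q x) with q;
  rewrite ?Dr, ?Dz, ?Dp, ?Dq; try (field; auto).
repeat apply conj; auto;
  repeat apply Rmult_integral_contrapositive_currified; auto; lra.
Qed.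

Lemma orbit_vec_pd_s :
  is_derive4 (fun x => orbit_vec (r x) t) s (vscal (c / L) (orbit_vec (r s) t)).
Proof.
assert (Er : ex_derive r s) by (eexists; exact Hr).
assert (Dr := is_derive_unique r s _ Hr).
unfold orbit_vec; refine (conj _ (conj _ (conj _ _))); simpl;
  auto_derive; auto;
  change (fun x => r x) with r; rewrite ?Dr; try (field; auto).
Qed.

End FrameDerivatives.

Lemma point_pd_t L r z t :
  is_derive4 (fun y => point L r z y) t (orbit_vec r t).
Proof.
unfold point, orbit_vec; refine (conj _ (conj _ (conj _ _))); simpl;
  auto_derive; auto; field.
Qed.

Lemma profile_vec_pd_t L r z t p q :
  L <> 0 ->
  is_derive4 (fun y => profile_vec L r z y p q) t (vscal (p / L) (orbit_vec r t)).
Proof.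
intros hL.
unfold profile_vec, orbit_vec; refine (conj _ (conj _ (conj _ _))); simpl;
  auto_derive; auto; try (field; auto).
Qed.

Lemma orbit_vec_pd_t L r z t :
  L <> 0 -> r <> 0 ->
  is_derive4 (fun y => orbit_vec r y) t
    (vadd (profile_vec L r z t (r ^ 2 / L) 0)
          (vscal (- (r ^ 2 / L ^ 2)) (point L r z t))).
Proof.
intros hL hr.
unfold point, profile_vec, orbit_vec; refine (conj _ (conj _ (conj _ _))); simpl;
  auto_derive; auto; try (field; auto).
Qed.

(** * Second-order operators along a map *)

Definition metric_trace (g : metric) (Q : idx -> idx -> vec4) (s t : R) : vec4 :=
  vsum2 (fun a => vsum2 (fun b => vscal (ginv g a b s t) (Q a b))).

(** [Q a b] stands for the second derivatives [nabla_a nabla_b] and [G] for the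
    first derivatives, of the map itself or of a field along the map: the traces
    of the two Hessians are the tension field and the rough Laplacian. *)
Definition hess (g : metric) (Q : idx -> idx -> vec4) (G : idx -> vec4)
    (s t : R) (a b : idx) : vec4 :=
  vsub (Q a b) (vsum2 (fun k => vscal (christoffel g k a b s t) (G k))).

Lemma projT_vsum2 L p F :
  projT L p (vsum2 F) = vsum2 (fun i => projT L p (F i)).
Proof. apply projT_add. Qed.

Lemma nablaPhi_eq L phi W F G s t :
  (forall b, projT L (phi s t) (pd4 b F s t) = G b) ->
  nablaPhi L phi W F s t = vsum2 (fun b => vscal (W b s t) (G b)).
Proof.
intros H; unfold nablaPhi; rewrite projT_vsum2; unfold vsum2.
rewrite !projT_scal, !H; reflexivity.
Qed.

Lemma pd_coord a i j s t : pd a (coord i j) s t = 0.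
Proof.
apply pd_unique; destruct a;
  exact (is_derive_constR (if idx_eqb i j then 1 else 0) _).
Qed.

Lemma nablaM_coord g a b k s t :
  nablaM g (coord a) (coord b) k s t = christoffel g k a b s t.
Proof.
unfold nablaM, sum2; rewrite !pd_coord; unfold coord.
destruct a, b; simpl; ring.
Qed.

Lemma tension_trace L g phi E D s t :
  (forall b, pd4 b phi s t = E b) ->
  (forall a b, is_pd4 a (dmap phi (coord b)) s t (D a b)) ->
  tension L g phi s t =
  metric_trace g (hess g (fun a b => projT L (phi s t) (D a b)) E s t) s t.
Proof.
intros HE HD; unfold tension, metric_trace.
assert (H : forall a b, second_form L g phi (coord a) (coord b) s t =
  hess g (fun a b => projT L (phi s t) (D a b)) E s t a b).
{ intros a b; unfold second_form, hess; f_equal.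
  - rewrite nablaPhi_eq with (G := fun a => projT L (phi s t) (D a b)).
    + unfold vsum2, coord; destruct a; simpl; vec4_ring.
    + intros a'; rewrite (pd4_unique _ _ _ _ _ (HD a' b)); reflexivity.
  - unfold dmap, vsum2; rewrite !nablaM_coord, !HE; reflexivity. }
unfold vsum2; rewrite !H; reflexivity.
Qed.

Lemma smooth_is_pd Om f i s t :
  smooth Om f -> Om s t -> is_pd i f s t (pd i f s t).
Proof.
intros Hf Hst; destruct (Hf s t Hst 1%nat) as (_ & H1 & H2 & _).
destruct i; apply Derive_correct; assumption.
Qed.

(** In [nabla_{e_i} nabla_{e_i} F - nabla_{nabla_{e_i} e_i} F] the derivatives of
    the components of the frame cancel; only the components of
    [sum_i eps_i e_i e_i], which is the inverse metric, remain. *)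
Lemma rough_laplacian_trace L Om g phi e eps F G D s t :
  L <> 0 -> open_2d Om -> Om s t -> AdS3 L (phi s t) ->
  (forall i k, smooth Om (e i k)) ->
  (forall a b, sum2 (fun i => eps i * (e i a s t * e i b s t)) = ginv g a b s t) ->
  (forall b s t, Om s t -> projT L (phi s t) (pd4 b F s t) = G b s t) ->
  (forall a b, is_pd4 a (G b) s t (D a b)) ->
  rough_laplacian L g phi e eps F s t =
  metric_trace g
    (hess g (fun a b => projT L (phi s t) (D a b)) (fun b => G b s t) s t) s t.
Proof.
intros hL HO Hst Hphi He Hinv HG HD.
assert (HPG : forall b, projT L (phi s t) (G b s t) = G b s t).
{ intros b; rewrite <- (HG b s t Hst); apply projT_idem; assumption. }
assert (H2 : forall i, nablaPhi L phi (e i) (nablaPhi L phi (e i) F) s t =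
  vsum2 (fun a => vscal (e i a s t) (vsum2 (fun b =>
    vadd (vscal (pd a (e i b) s t) (G b s t))
         (vscal (e i b s t) (projT L (phi s t) (D a b))))))).
{ intros i; apply nablaPhi_eq; intros a.
  rewrite (pd4_unique a _ s t (vsum2 (fun b =>
    vadd (vscal (pd a (e i b) s t) (G b s t)) (vscal (e i b s t) (D a b))))).
  - rewrite projT_vsum2; unfold vsum2.
    rewrite !projT_add, !projT_scal, !HPG; reflexivity.
  - apply is_pd4_ext_loc
      with Om (fun s t => vsum2 (fun b => vscal (e i b s t) (G b s t)));
      [exact HO | exact Hst | |].
    + intros x y Hxy; symmetry; apply nablaPhi_eq; intros b; apply HG, Hxy.
    + apply is_pd4_add; apply is_pd4_scal; try apply HD;
        apply smooth_is_pd with Om; auto. }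
assert (H1 : forall i, nablaPhi L phi (nablaM g (e i) (e i)) F s t =
  vsum2 (fun b => vscal (nablaM g (e i) (e i) b s t) (G b s t))).
{ intros i; apply nablaPhi_eq; intros b; apply HG, Hst. }
unfold rough_laplacian, metric_trace, hess.
unfold vsum2 at 1; rewrite !H1, !H2.
unfold vsum2, nablaM; rewrite <- !Hinv; unfold sum2.
vec4_components; ring.
Qed.

(** ** Pseudo-orthonormal frames in dimension two *)

Lemma left_inverse_right_inverse_2x2 a b c d a' b' c' d' :
  a * a' + b * c' = 1 -> a * b' + b * d' = 0 ->
  c * a' + d * c' = 0 -> c * b' + d * d' = 1 ->
  a' * a + b' * c = 1 /\ a' * b + b' * d = 0 /\
  c' * a + d' * c = 0 /\ c' * b + d' * d = 1.
Proof.
intros H1 H2 H3 H4.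
assert (Hdet : (a * d - b * c) * (a' * d' - b' * c') = 1).
{ replace 1 with (1 * 1 - 0 * 0) by ring.
  rewrite <- H1 at 1; rewrite <- H4, <- H2 at 1; rewrite <- H3; ring. }
set (m := a * d - b * c) in *.
assert (Hm : m <> 0) by (intros E; rewrite E in Hdet; lra).
assert (Ea : m * a' = d).
{ replace (m * a') with (d * (a * a' + b * c') - b * (c * a' + d * c'))
    by (unfold m; ring). rewrite H1, H3; ring. }
assert (Eb : m * b' = - b).
{ replace (m * b') with (d * (a * b' + b * d') - b * (c * b' + d * d'))
    by (unfold m; ring). rewrite H2, H4; ring. }
assert (Ec : m * c' = - c).
{ replace (m * c') with (a * (c * a' + d * c') - c * (a * a' + b * c'))
    by (unfold m; ring). rewrite H1, H3; ring. }
assert (Ed : m * d' = a).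
{ replace (m * d') with (a * (c * b' + d * d') - c * (a * b' + b * d'))
    by (unfold m; ring). rewrite H2, H4; ring. }
assert (K : forall x y, m * x = m * y -> x = y)
  by (intros x y E; exact (Rmult_eq_reg_l m x y E Hm)).
repeat apply conj; apply K.
- replace (m * (a' * a + b' * c)) with (m * a' * a + m * b' * c) by ring.
  rewrite Ea, Eb; unfold m; ring.
- replace (m * (a' * b + b' * d)) with (m * a' * b + m * b' * d) by ring.
  rewrite Ea, Eb; ring.
- replace (m * (c' * a + d' * c)) with (m * c' * a + m * d' * c) by ring.
  rewrite Ec, Ed; ring.
- replace (m * (c' * b + d' * d)) with (m * c' * b + m * d' * d) by ring.
  rewrite Ec, Ed; unfold m; ring.
Qed.

(** Orthonormality says that the matrix [eps e^T g] is a left inverse of [e];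
    hence it is a right inverse, and [e eps e^T] is the inverse of [g]. *)
Lemma ortho_frame_complete Om g e eps s t :
  ortho_frame Om g e eps -> Om s t ->
  gdet g s t <> 0 ->
  forall a b, sum2 (fun i => eps i * (e i a s t * e i b s t)) = ginv g a b s t.
Proof.
intros (_ & Heps & Hort) Hst Hdet.
assert (E1 : forall i, eps i * eps i = 1)
  by (intros i; destruct (Heps i) as [-> | ->]; ring).
pose (row i j := eps i * sum2 (fun a => e i a s t * g a j s t)).
destruct (left_inverse_right_inverse_2x2
  (row i_s i_s) (row i_s i_t) (row i_t i_s) (row i_t i_t)
  (e i_s i_s s t) (e i_t i_s s t) (e i_s i_t s t) (e i_t i_t s t))
  as (H1 & H2 & H3 & H4).
- rewrite <- (E1 i_s); rewrite <- (Hort i_s i_s s t Hst : _ = eps i_s) at 2.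
  unfold row, gprod, sum2; ring.
- transitivity (eps i_s * 0); [| ring].
  rewrite <- (Hort i_s i_t s t Hst : _ = 0); unfold row, gprod, sum2; ring.
- transitivity (eps i_t * 0); [| ring].
  rewrite <- (Hort i_t i_s s t Hst : _ = 0); unfold row, gprod, sum2; ring.
- rewrite <- (E1 i_t); rewrite <- (Hort i_t i_t s t Hst : _ = eps i_t) at 2.
  unfold row, gprod, sum2; ring.
- set (N a b := sum2 (fun i => eps i * (e i a s t * e i b s t))).
  assert (K : forall x y, x * gdet g s t = y -> x = y / gdet g s t)
    by (intros x y <-; field; exact Hdet).
  assert (N1 : N i_s i_s * g i_s i_s s t + N i_s i_t * g i_t i_s s t = 1)
    by (rewrite <- H1; unfold N, row, sum2; ring).
  assert (N2 : N i_s i_s * g i_s i_t s t + N i_s i_t * g i_t i_t s t = 0)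
    by (rewrite <- H2; unfold N, row, sum2; ring).
  assert (N3 : N i_t i_s * g i_s i_s s t + N i_t i_t * g i_t i_s s t = 0)
    by (rewrite <- H3; unfold N, row, sum2; ring).
  assert (N4 : N i_t i_s * g i_s i_t s t + N i_t i_t * g i_t i_t s t = 1)
    by (rewrite <- H4; unfold N, row, sum2; ring).
  intros a b; change (N a b = ginv g a b s t).
  destruct a, b; simpl; apply K; unfold gdet.
  + transitivity ((N i_s i_s * g i_s i_s s t + N i_s i_t * g i_t i_s s t) * g i_t i_t s t
      - (N i_s i_s * g i_s i_t s t + N i_s i_t * g i_t i_t s t) * g i_t i_s s t);
      [ring | rewrite N1, N2; ring].
  + transitivity ((N i_s i_s * g i_s i_t s t + N i_s i_t * g i_t i_t s t) * g i_s i_s s t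
      - (N i_s i_s * g i_s i_s s t + N i_s i_t * g i_t i_s s t) * g i_s i_t s t);
      [ring | rewrite N1, N2; ring].
  + transitivity ((N i_t i_s * g i_s i_s s t + N i_t i_t * g i_t i_s s t) * g i_t i_t s t
      - (N i_t i_s * g i_s i_t s t + N i_t i_t * g i_t i_t s t) * g i_t i_s s t);
      [ring | rewrite N3, N4; ring].
  + transitivity ((N i_t i_s * g i_s i_t s t + N i_t i_t * g i_t i_t s t) * g i_s i_s s t
      - (N i_t i_s * g i_s i_s s t + N i_t i_t * g i_t i_s s t) * g i_s i_t s t);
      [ring | rewrite N3, N4; ring].
Qed.

(** ** Conformal changes of a warped product metric *)

Definition conformal_warped (m r : R -> R) : metric := fun i j s _ =>
  m s * match i, j with i_s, i_s => 1 | i_t, i_t => - r s ^ 2 | _, _ => 0 end.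

Section ConformalWarped.

Context (m r : R -> R) (s t dm dr : R).
Context (Hm : is_derive m s dm) (Hr : is_derive r s dr).
Context (Hm0 : m s <> 0) (Hr0 : r s <> 0).

Lemma gdet_conformal_warped :
  gdet (conformal_warped m r) s t = - (m s * r s) ^ 2.
Proof. unfold gdet, conformal_warped; ring. Qed.

Lemma pd_conformal_warped a i j :
  pd a (conformal_warped m r i j) s t =
  match a, i, j with
  | i_s, i_s, i_s => dm
  | i_s, i_t, i_t => - (dm * r s ^ 2 + 2 * m s * r s * dr)
  | _, _, _ => 0
  end.
Proof.
assert (Em : ex_derive m s) by (eexists; exact Hm).
assert (Er : ex_derive r s) by (eexists; exact Hr).
assert (Dm := is_derive_unique m s _ Hm).
assert (Dr := is_derive_unique r s _ Hr).
apply pd_unique; destruct a, i, j; unfold conformal_warped; simpl;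
  auto_derive; auto;
  change (fun x => r x) with r; change (fun x => m x) with m;
  rewrite ?Dm, ?Dr; ring.
Qed.

(** The factor [m] appears only as the factor [/ m] in front, its derivative does
    not appear: in dimension two the trace of the Hessian is conformally
    covariant. *)
Lemma metric_trace_conformal_warped Q G :
  metric_trace (conformal_warped m r) (hess (conformal_warped m r) Q G s t) s t =
  vscal (/ m s)
    (vadd (vadd (Q i_s i_s) (vscal (dr / r s) (G i_s)))
          (vscal (- / r s ^ 2) (Q i_t i_t))).
Proof.
assert (Hd : - (m s * r s) ^ 2 <> 0).
{ assert (m s * r s <> 0) by (apply Rmult_integral_contrapositive_currified; auto).
  nra. }
unfold metric_trace, hess, vsum2, christoffel, ginv, sum2.
rewrite !pd_conformal_warped, gdet_conformal_warped.
unfold conformal_warped; vec4_components; field; split; assumption.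
Qed.

End ConformalWarped.

(** ** The curvature term of the bitension field *)

Lemma ip_dmap phi W W' s t :
  ip (dmap phi W s t) (dmap phi W' s t) = gprod (pullback phi) W W' s t.
Proof.
unfold dmap, vsum2, gprod, sum2, pullback.
autorewrite with ip_lin; ring.
Qed.

(** For a field normal to the surface only the multiple of the field in the
    constant-curvature tensor contributes, once for each frame vector. *)
Lemma curvature_term_normal L Om g phi e eps mu v s t :
  L <> 0 -> ortho_frame Om g e eps -> Om s t -> AdS3 L (phi s t) ->
  (forall i, ip (pd4 i phi s t) (phi s t) = 0) ->
  (forall i j, pullback phi i j s t = mu * g i j s t) ->
  ip v (phi s t) = 0 -> (forall i, ip v (pd4 i phi s t) = 0) ->
  vsum2 (fun i => vscal (eps i)
    (RN L (phi s t) (dmap phi (e i) s t) v (dmap phi (e i) s t))) =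
  vscal (2 * mu / L ^ 2) v.
Proof.
intros hL (_ & Heps & Hort) Hst Hphi Htan Hmu Hv Hnor.
assert (T : forall W, ip (dmap phi W s t) (phi s t) = 0).
{ intros W; unfold dmap, vsum2; autorewrite with ip_lin.
  rewrite !Htan; ring. }
assert (N : forall W, ip v (dmap phi W s t) = 0).
{ intros W; unfold dmap, vsum2; autorewrite with ip_lin.
  rewrite !Hnor; ring. }
assert (S : forall i, ip (dmap phi (e i) s t) (dmap phi (e i) s t) = mu * eps i).
{ intros i; rewrite ip_dmap.
  assert (E := Hort i i s t Hst).
  replace (if idx_eqb i i then eps i else 0) with (eps i) in E
    by (destruct i; reflexivity).
  rewrite <- E; unfold gprod, sum2; rewrite !Hmu; ring. }
assert (E1 : forall i, eps i * eps i = 1)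
  by (intros i; destruct (Heps i) as [-> | ->]; ring).
assert (K : forall i, vscal (eps i)
  (RN L (phi s t) (dmap phi (e i) s t) v (dmap phi (e i) s t)) =
  vscal (mu / L ^ 2) v).
{ intros i; rewrite RN_tangent by auto; rewrite S, N.
  replace (mu / L ^ 2) with (eps i * (mu * eps i / L ^ 2)).
  2:{ transitivity (eps i * eps i * (mu / L ^ 2));
      [unfold Rdiv; ring | rewrite E1; ring]. }
  unfold Rdiv; vec4_ring. }
unfold vsum2; rewrite !K; unfold Rdiv; vec4_ring.
Qed.

(** * The surface and its shape operator *)

Lemma parabolic_subgroup_Pt : parabolic_subgroup Pt.
Proof.
split; [| split; [| split; [| split]]].
- intros t a x y; vec4_components; unfold Pt; simpl; ring.
- intros t x y; unfold ip, Pt; simpl; field.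
- intros x; vec4_components; unfold Pt; simpl; ring.
- intros t t' x; vec4_components; unfold Pt; simpl; field.
(* The generator [B]; its square maps [(U, V, Y, Z)] to [(0, - U, 0, 0)]. *)
- exists (fun x => mkvec4 0 (- cY x) (cU x) 0); split; [| split].
  + intros x; unfold Pt; simpl.
    refine (conj _ (conj _ (conj _ _))); auto_derive; auto; ring.
  + intros x; apply vec4_eq; simpl; ring.
  + exists (mkvec4 1 0 0 0); intros E; assert (H := f_equal cV E).
    simpl in H; lra.
Qed.

Section Surface.

Context (L rho0 Z0 : R) (I J : R -> Prop) (theta Z : R -> R).
Context (hL : 0 < L) (hrho0 : 0 < rho0).
Context (HI : is_open_interval I) (HI0 : I 0) (HJ : is_open_interval J).
Context (Hth : theta_solution L I theta) (HZ : Z_solution L Z0 I theta Z).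

Let X := surf L rho0 theta Z.
Let r := rho L rho0 theta.
Let Om := rect I J.

Let hL0 : L <> 0.
Proof. lra. Qed.

Let HIo : open I := proj1 HI.

Let Hr0 s : r s <> 0.
Proof. apply Rgt_not_eq, rho_pos, hrho0. Qed.

Let H2r s : 2 * r s <> 0.
Proof. apply Rmult_integral_contrapositive_currified; [lra | apply Hr0]. Qed.

Let H2rL s : 2 * r s * L <> 0.
Proof. apply Rmult_integral_contrapositive_currified; [apply H2r | lra]. Qed.

Let Hcn s : cos (theta s) ^ 2 + sin (theta s) ^ 2 = 1.
Proof. rewrite <- (sin2_cos2 (theta s)); unfold Rsqr; ring. Qed.

Let Hdr s (Hs : I s) : is_derive r s (cos (theta s) / L * r s).
Proof. apply (rho_is_derive L I); assumption. Qed.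

Let Hdz s (Hs : I s) : is_derive Z s (cos (theta s) / L * Z s + sin (theta s)).
Proof. apply HZ, Hs. Qed.

Lemma open_rect : open_2d Om.
Proof. apply open_2d_rect; [exact HIo | exact (proj1 HJ)]. Qed.

Definition frame_field (p q : R -> R) (s t : R) : vec4 :=
  profile_vec L (r s) (Z s) t (p s) (q s).

Definition normal_field : R -> R -> vec4 :=
  frame_field (fun s => - sin (theta s)) (fun s => cos (theta s)).

Definition tangent_field (i : idx) : R -> R -> vec4 :=
  match i with
  | i_s => frame_field (fun s => cos (theta s)) (fun s => sin (theta s))
  | i_t => fun s t => orbit_vec (r s) t
  end.

Lemma surf_is_pd4 i s t : I s -> is_pd4 i X s t (tangent_field i s t).
Proof.
intros Hs; destruct i; simpl.
- apply (point_pd_s L s t r Z); auto.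
- exact (point_pd_t L (r s) (Z s) t).
Qed.

Lemma surf_pd4 i s t : I s -> pd4 i X s t = tangent_field i s t.
Proof. intros Hs; apply pd4_unique, surf_is_pd4, Hs. Qed.

(** The component along [X] is the second fundamental form of [AdS_3] in
    [R^{2,2}]; it drops out of covariant derivatives. *)
Lemma frame_field_pd_s p q dp dq s t :
  I s -> is_derive p s dp -> is_derive q s dq ->
  is_pd4 i_s (frame_field p q) s t
    (vadd (profile_vec L (r s) (Z s) t
             (dp - q s * (sin (theta s) / L)) (dq + p s * (sin (theta s) / L)))
          (vscal ((p s * cos (theta s) + q s * sin (theta s)) / L ^ 2)
             (X s t))).
Proof.
intros Hs Hp Hq; apply (profile_vec_pd_s L s t r Z); auto.
Qed.

Lemma frame_field_pd_t p q s t :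
  is_pd4 i_t (frame_field p q) s t (vscal (p s / L) (orbit_vec (r s) t)).
Proof. apply profile_vec_pd_t, hL0. Qed.

Lemma orbit_field_pd_s s t :
  I s -> is_pd4 i_s (tangent_field i_t) s t
    (vscal (cos (theta s) / L) (orbit_vec (r s) t)).
Proof. intros Hs; apply (orbit_vec_pd_s L s t r); auto. Qed.

Lemma orbit_field_pd_t s t :
  is_pd4 i_t (tangent_field i_t) s t
    (vadd (profile_vec L (r s) (Z s) t (r s ^ 2 / L) 0)
          (vscal (- (r s ^ 2 / L ^ 2)) (X s t))).
Proof. apply orbit_vec_pd_t; auto. Qed.

Lemma surf_AdS3 s t : AdS3 L (X s t).
Proof. apply point_AdS3, Hr0. Qed.

Lemma ip_tangent_surf i s t : ip (tangent_field i s t) (X s t) = 0.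
Proof.
destruct i; [apply ip_profile_point; auto | apply ip_orbit_point].
Qed.

Lemma projT_profile_field s t p q :
  projT L (X s t) (profile_vec L (r s) (Z s) t p q) =
  profile_vec L (r s) (Z s) t p q.
Proof. apply projT_profile; auto. Qed.

Lemma projT_orbit_field s t :
  projT L (X s t) (orbit_vec (r s) t) = orbit_vec (r s) t.
Proof. apply projT_orbit. Qed.

Lemma ip_tangent_tangent i j s t :
  ip (tangent_field i s t) (tangent_field j s t) = gsurf L rho0 theta i j s t.
Proof.
destruct i, j; simpl.
- unfold frame_field; rewrite ip_profile_profile by auto.
  rewrite <- (Hcn s); ring.
- apply ip_profile_orbit; auto.
- rewrite ip_sym; apply ip_profile_orbit; auto.
- apply ip_orbit_orbit.
Qed.

Lemma ip_normal_tangent i s t : ip (normal_field s t) (tangent_field i s t) = 0.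
Proof.
destruct i; simpl; [| apply ip_profile_orbit; auto].
unfold normal_field, frame_field; rewrite ip_profile_profile by auto; ring.
Qed.

Let r_smooth : smooth1 I r.
Proof. apply smooth1_rho; assumption. Qed.
Let Z_smooth : smooth1 I Z.
Proof. apply (smooth1_Z L I theta) with Z0; assumption. Qed.

Lemma frame_field_smooth p q :
  smooth1 I p -> smooth1 I q -> smooth4 Om (frame_field p q).
Proof.
intros Hp Hq; assert (HO := open_rect).
assert (HU : smooth1 I (fun s => p s * r s / L)) by smooth1_tac.
unfold frame_field, profile_vec; refine (conj _ (conj _ (conj _ _))); simpl.
- apply smooth_of_first; [exact HIo | exact (proj1 HJ) | exact HU].
- apply smooth_ext with (fun s t =>
    (p s * (Z s ^ 2 - L ^ 2) / (2 * r s * L) + q s * Z s / r s) + 0 * t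
    + - / 2 * (p s * r s / L) * t ^ 2); [exact HO | intros; unfold r, Rdiv; ring |].
  apply (smooth_quadratic I J
    (fun s => p s * (Z s ^ 2 - L ^ 2) / (2 * r s * L) + q s * Z s / r s)
    (fun _ => 0) (fun s => - / 2 * (p s * r s / L)));
    try exact (proj1 HJ); smooth1_tac; auto.
- apply smooth_ext with (fun s t => 0 + (p s * r s / L) * t + 0 * t ^ 2);
    [exact HO | intros; unfold r, Rdiv; ring |].
  apply (smooth_quadratic I J (fun _ => 0) (fun s => p s * r s / L)
    (fun _ => 0)); try exact (proj1 HJ); smooth1_tac.
- apply smooth_of_first; [exact HIo | exact (proj1 HJ) | smooth1_tac].
Qed.

Lemma surf_smooth : smooth4 Om X.
Proof.
assert (HO := open_rect).
unfold X, surf; refine (conj _ (conj _ (conj _ _))); simpl.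
- apply smooth_of_first; [exact HIo | exact (proj1 HJ) | exact r_smooth].
- apply smooth_ext with (fun s t =>
    (L ^ 2 + Z s ^ 2) / (2 * r s) + 0 * t + - / 2 * r s * t ^ 2);
    [exact HO | intros; unfold r, Rdiv; ring |].
  apply (smooth_quadratic I J
    (fun s => (L ^ 2 + Z s ^ 2) / (2 * r s)) (fun _ => 0)
    (fun s => - / 2 * r s));
    try exact (proj1 HJ); smooth1_tac; auto.
- apply smooth_ext with (fun s t => 0 + r s * t + 0 * t ^ 2);
    [exact HO | intros; unfold r, Rdiv; ring |].
  apply (smooth_quadratic I J (fun _ => 0) r
    (fun _ => 0)); try exact (proj1 HJ); smooth1_tac.
- apply smooth_of_first; [exact HIo | exact (proj1 HJ) | exact Z_smooth].
Qed.

Lemma surf_maps_to_AdS3 : maps_to_AdS3 L Om X.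
Proof. split; [exact surf_smooth | intros s t _; apply surf_AdS3]. Qed.

Lemma surf_induced_metric : induced_metric Om X (gsurf L rho0 theta).
Proof.
intros i j s t [Hs _]; unfold pullback.
rewrite !surf_pd4 by exact Hs; apply ip_tangent_tangent.
Qed.

Lemma normal_field_unit : unit_spacelike_normal Om X normal_field.
Proof.
assert (HC := smooth1_cos_theta L I theta hL0 HIo Hth).
assert (HS := smooth1_sin_theta L I theta hL0 HIo Hth).
split.
- apply frame_field_smooth; smooth1_tac.
- intros s t [Hs _]; split; [| split].
  + apply ip_profile_point; auto.
  + intros i; rewrite surf_pd4 by exact Hs; apply ip_normal_tangent.
  + unfold normal_field, frame_field; rewrite ip_profile_profile by auto.
    rewrite <- (Hcn s); ring.
Qed.

Definition surf_shape : endo := fun j i s _ =>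
  match j, i with
  | i_s, i_s => k1 L theta s
  | i_t, i_t => k2 L theta s
  | _, _ => 0
  end.

(** Along the profile the derivative of [xi] follows from the rotation of the
    frame; along the orbits it is the generator of [Pt] applied to [xi], which is
    a multiple of [X_t]. *)
Lemma surf_shape_operator : shape_operator L Om X normal_field surf_shape.
Proof.
intros W s t [Hs _].
assert (Hc := cos_theta_is_derive L I theta Hth s Hs).
assert (Hn := sin_theta_is_derive L I theta Hth s Hs).
rewrite nablaPhi_eq with (G := fun i => vscal
  (- match i with i_s => k1 L theta s | i_t => k2 L theta s end)
  (tangent_field i s t)).
- unfold dmap, vsum2; rewrite !surf_pd4 by exact Hs.
  unfold apply_endo, sum2; simpl; vec4_ring.
- intros b; destruct b.
  + rewrite (pd4_unique i_s normal_field s t _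
      (frame_field_pd_s (fun s => - sin (theta s)) (fun s => cos (theta s))
         _ _ s t Hs (is_derive_oppR _ _ _ Hn) Hc)).
    rewrite projT_add, projT_scal, (projT_normal _ _ hL0 (surf_AdS3 s t)).
    rewrite projT_profile_field; simpl; unfold frame_field.
    rewrite profile_vec_scal by auto.
    rewrite vscal_zero, vadd_zero; unfold k1; f_equal; unfold Rdiv; ring.
  + rewrite (pd4_unique i_t normal_field s t _ (frame_field_pd_t _ _ s t)).
    rewrite projT_scal, projT_orbit_field.
    simpl; unfold k2, Rdiv; vec4_ring.
Qed.

Lemma surf_principal_curvatures s t :
  principal_curvature surf_shape (coord i_s) (k1 L theta s) s t /\
  principal_curvature surf_shape (coord i_t) (k2 L theta s) s t.
Proof.
split; split.
- exists i_s; unfold coord; simpl; lra.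
- intros j; unfold apply_endo, sum2, coord, surf_shape; destruct j; simpl; ring.
- exists i_t; unfold coord; simpl; lra.
- intros j; unfold apply_endo, sum2, coord, surf_shape; destruct j; simpl; ring.
Qed.

(** * The conformal metric and the tension field *)

Context (u0 : R).
Context (HH : forall s, I s -> meanH L theta s <> 0).
Context (Hlam : forall s, I s -> 0 < lambda2 L u0 theta s).

Let m s := / lambda2 L u0 theta s.
Let g := conformal_warped m r.
Let u := ufun L u0 theta.

Let Hm0 s (Hs : I s) : m s <> 0.
Proof. apply Rinv_neq_0_compat, Rgt_not_eq, Hlam, Hs. Qed.

Lemma smooth1_conformal_factor : smooth1 I m.
Proof.
assert (HU := smooth1_ufun L I theta hL0 HI HI0 Hth u0).
assert (HM := smooth1_meanH L I theta hL0 HIo Hth).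
unfold m, lambda2; smooth1_tac; try exact HH.
intros s Hs; apply Rgt_not_eq, Hlam, Hs.
Qed.

Let Hdm s (Hs : I s) : is_derive m s (Derive m s).
Proof. apply smooth1_is_derive with I; [exact smooth1_conformal_factor | exact Hs]. Qed.

Lemma conformal_metric_pseudo_riemannian : pseudo_riemannian Om g.
Proof.
assert (HM := smooth1_conformal_factor).
split.
- intros i j; unfold g, conformal_warped.
  apply smooth_of_first; [exact HIo | exact (proj1 HJ) |].
  destruct i, j; smooth1_tac.
- intros s t [Hs _]; split.
  + intros i j; unfold g, conformal_warped; destruct i, j; reflexivity.
  + unfold g; rewrite gdet_conformal_warped.
    assert (m s * r s <> 0)
      by (apply Rmult_integral_contrapositive_currified; auto).
    nra.
Qed.

Lemma pullback_conformal s t i j :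
  I s -> pullback X i j s t = lambda2 L u0 theta s * g i j s t.
Proof.
intros Hs; unfold pullback; rewrite !surf_pd4, ip_tangent_tangent by exact Hs.
unfold g, conformal_warped, m, gsurf, r; rewrite <- Rmult_assoc, Rinv_r.
- destruct i, j; ring.
- apply Rgt_not_eq, Hlam, Hs.
Qed.

Lemma surf_conformal_immersion : conformal_immersion L Om g X.
Proof.
split; [exact conformal_metric_pseudo_riemannian |].
split; [exact surf_maps_to_AdS3 |].
split.
- intros s t [Hs _] W HW.
  assert (K : forall i, ip (dmap X W s t) (tangent_field i s t) =
    W i s t * gsurf L rho0 theta i i s t).
  { intros i; unfold dmap, vsum2; rewrite !surf_pd4 by exact Hs.
    autorewrite with ip_lin; rewrite !ip_tangent_tangent.
    destruct i; unfold gsurf; ring. }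
  intros i; apply (Rmult_eq_reg_r (gsurf L rho0 theta i i s t)).
  + rewrite <- K, HW; unfold ip; simpl; ring.
  + destruct i; unfold gsurf; [lra |].
    apply Ropp_neq_0_compat, pow_nonzero, Hr0.
- exists (fun s _ => lambda2 L u0 theta s); split.
  + intros s t [Hs _]; apply Hlam, Hs.
  + intros i j s t [Hs _]; apply pullback_conformal, Hs.
Qed.

Lemma trace_conformal_metric Q G s t :
  I s ->
  metric_trace g (hess g Q G s t) s t =
  vscal (lambda2 L u0 theta s)
    (vadd (vadd (Q i_s i_s) (vscal (cos (theta s) / L) (G i_s)))
          (vscal (- / r s ^ 2) (Q i_t i_t))).
Proof.
intros Hs; unfold g.
rewrite (metric_trace_conformal_warped m r s t _ _ (Hdm s Hs) (Hdr s Hs)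
  (Hm0 s Hs) (Hr0 s)).
unfold m at 1; rewrite Rinv_inv.
replace (cos (theta s) / L * r s / r s) with (cos (theta s) / L); [reflexivity |].
field; split; auto.
Qed.

(** In dimension two the tension field is [lambda^2] times the tension field
    [2 H xi] of the isometric immersion, and [lambda^2 = u / H]. *)
Lemma surf_tension s t :
  Om s t ->
  tension L g X s t =
  frame_field (fun s => - 2 * u s * sin (theta s))
    (fun s => 2 * u s * cos (theta s)) s t.
Proof.
intros Hst; assert (Hs := proj1 Hst).
assert (Hc := cos_theta_is_derive L I theta Hth s Hs).
assert (Hn := sin_theta_is_derive L I theta Hth s Hs).
pose (D a b := match a, b with
  | i_s, i_s => vadd (profile_vec L (r s) (Z s) t
      (- sin (theta s) * Derive theta s - sin (theta s) * (sin (theta s) / L))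
      (cos (theta s) * Derive theta s + cos (theta s) * (sin (theta s) / L)))
      (vscal ((cos (theta s) * cos (theta s) + sin (theta s) * sin (theta s))
              / L ^ 2) (X s t))
  | i_t, i_s => vscal (cos (theta s) / L) (orbit_vec (r s) t)
  | i_s, i_t => vscal (cos (theta s) / L) (orbit_vec (r s) t)
  | i_t, i_t => vadd (profile_vec L (r s) (Z s) t (r s ^ 2 / L) 0)
      (vscal (- (r s ^ 2 / L ^ 2)) (X s t))
  end).
rewrite (tension_trace L g X (fun b => tangent_field b s t) D s t).
- rewrite trace_conformal_metric by exact Hs; simpl.
  rewrite !projT_add, !projT_scal, (projT_normal _ _ hL0 (surf_AdS3 s t)).
  rewrite !projT_profile_field, !vscal_zero, !vadd_zero.
  unfold frame_field.
  rewrite !profile_vec_scal, !profile_vec_add, !profile_vec_scal by auto.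
  assert (H0 := HH s Hs).
  assert (Hc2 : cos (theta s) ^ 2 = 1 - sin (theta s) ^ 2)
    by (rewrite <- (Hcn s); ring).
  f_equal.
  + transitivity (lambda2 L u0 theta s
      * (- 2 * sin (theta s) * meanH L theta s)).
    * unfold meanH; apply f_equal; transitivity
        (- sin (theta s) * Derive theta s
         + (cos (theta s) ^ 2 - sin (theta s) ^ 2 - 1) / L);
        [field; split; auto | rewrite Hc2; field; exact hL0].
    * unfold lambda2, u; field; exact H0.
  + transitivity (lambda2 L u0 theta s
      * (2 * cos (theta s) * meanH L theta s)).
    * unfold meanH; field; split; auto.
    * unfold lambda2, u; field; exact H0.
- intros b; apply surf_pd4, Hs.
- intros a b; apply is_pd4_ext_loc with Om (tangent_field b);
    [exact open_rect | exact Hst | |].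
  + intros x y [Hx _]; unfold dmap, vsum2; rewrite !surf_pd4 by exact Hx.
    unfold coord; destruct b; simpl; vec4_ring.
  + destruct a, b; simpl D.
    * exact (frame_field_pd_s (fun s => cos (theta s)) (fun s => sin (theta s))
        _ _ s t Hs Hc Hn).
    * apply orbit_field_pd_s, Hs.
    * exact (frame_field_pd_t (fun s => cos (theta s))
        (fun s => sin (theta s)) s t).
    * apply orbit_field_pd_t.
Qed.

(** * The bitension field *)

(** The coordinate formula for fields [p E1 + q E2] in the moved horocyclic frame:
    the covariant derivative [(p' - q sin / L, q' + p sin / L)] along [s], taken
    twice, the drift [cos theta / L = rho' / rho], and [- p / L^2] from the rotation
    of the frame along the orbits. *)
Lemma rough_laplacian_frame_field Om' e eps F (p q dp dq : R -> R)
    (ddp ddq s t : R) :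
  open_2d Om' -> (forall s t, Om' s t -> Om s t) -> ortho_frame Om' g e eps ->
  Om' s t ->
  (forall s, I s -> is_derive p s (dp s)) ->
  (forall s, I s -> is_derive q s (dq s)) ->
  is_derive (fun s => dp s - q s * (sin (theta s) / L)) s ddp ->
  is_derive (fun s => dq s + p s * (sin (theta s) / L)) s ddq ->
  (forall s t, Om s t -> F s t = frame_field p q s t) ->
  rough_laplacian L g X e eps F s t =
  vscal (lambda2 L u0 theta s) (profile_vec L (r s) (Z s) t
    (ddp - (dq s + p s * (sin (theta s) / L)) * (sin (theta s) / L)
     + cos (theta s) / L * (dp s - q s * (sin (theta s) / L)) - p s / L ^ 2)
    (ddq + (dp s - q s * (sin (theta s) / L)) * (sin (theta s) / L)
     + cos (theta s) / L * (dq s + p s * (sin (theta s) / L)))).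
Proof.
intros HO' Hsub He Hst' Hp Hq Hp1 Hq1 HF.
assert (Hst := Hsub s t Hst'); assert (Hs := proj1 Hst).
set (p1 := fun s => dp s - q s * (sin (theta s) / L)) in *.
set (q1 := fun s => dq s + p s * (sin (theta s) / L)) in *.
pose (G b := match b with
  | i_s => frame_field p1 q1
  | i_t => fun s t => vscal (p s / L) (tangent_field i_t s t)
  end).
pose (D a b := match a, b with
  | i_s, i_s => vadd (profile_vec L (r s) (Z s) t
      (ddp - q1 s * (sin (theta s) / L)) (ddq + p1 s * (sin (theta s) / L)))
      (vscal ((p1 s * cos (theta s) + q1 s * sin (theta s)) / L ^ 2) (X s t))
  | i_t, i_s => vscal (p1 s / L) (orbit_vec (r s) t)
  | i_s, i_t => vadd (vscal (dp s * / L + p s * 0) (tangent_field i_t s t))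
      (vscal (p s / L) (vscal (cos (theta s) / L) (orbit_vec (r s) t)))
  | i_t, i_t => vadd (vscal 0 (tangent_field i_t s t))
      (vscal (p s / L) (vadd (profile_vec L (r s) (Z s) t (r s ^ 2 / L) 0)
         (vscal (- (r s ^ 2 / L ^ 2)) (X s t))))
  end).
rewrite (rough_laplacian_trace L Om' g X e eps F G D s t).
- rewrite trace_conformal_metric by exact Hs; simpl.
  rewrite !projT_add, !projT_scal, !projT_add, !projT_scal,
    (projT_normal _ _ hL0 (surf_AdS3 s t)), projT_orbit_field.
  rewrite !projT_profile_field, !vscal_zero, !vadd_zero.
  replace (vscal 0 (orbit_vec (r s) t)) with (profile_vec L (r s) (Z s) t 0 0)
    by (rewrite profile_vec_0 by auto; vec4_ring).
  unfold frame_field.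
  rewrite !profile_vec_scal, !profile_vec_add, !profile_vec_scal,
    !profile_vec_add, !profile_vec_scal by auto.
  unfold p1, q1; f_equal; field; repeat split; auto.
- exact hL0.
- exact HO'.
- exact Hst'.
- apply surf_AdS3.
- apply He.
- destruct (proj2 conformal_metric_pseudo_riemannian s t Hst) as [_ Hdet].
  exact (ortho_frame_complete Om' g e eps s t He Hst' Hdet).
- intros b x y Hxy; assert (Hx := proj1 (Hsub x y Hxy)); destruct b.
  + rewrite (pd4_unique i_s F x y _ (is_pd4_ext_loc Om i_s _ F x y _ open_rect
      (Hsub x y Hxy) (fun x y H => eq_sym (HF x y H))
      (frame_field_pd_s p q _ _ x y Hx (Hp x Hx) (Hq x Hx)))).
    rewrite projT_add, projT_scal, (projT_normal _ _ hL0 (surf_AdS3 x y)).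
    rewrite projT_profile_field, vscal_zero, vadd_zero; reflexivity.
  + rewrite (pd4_unique i_t F x y _ (is_pd4_ext_loc Om i_t _ F x y _ open_rect
      (Hsub x y Hxy) (fun x y H => eq_sym (HF x y H))
      (frame_field_pd_t p q x y))).
    rewrite projT_scal, projT_orbit_field; reflexivity.
- intros a b; destruct a, b; simpl D.
  + exact (frame_field_pd_s p1 q1 _ _ s t Hs Hp1 Hq1).
  + apply (is_pd4_scal i_s (fun s _ => p s / L) (tangent_field i_t)).
    * apply (is_derive_mulR p (fun _ => / L));
        [apply Hp, Hs | apply is_derive_constR].
    * apply orbit_field_pd_s, Hs.
  + exact (frame_field_pd_t p1 q1 s t).
  + apply (is_pd4_scal i_t (fun s _ => p s / L) (tangent_field i_t)).
    * exact (is_derive_constR (p s / L) t).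
    * apply orbit_field_pd_t.
Qed.

(** The tangential component vanishes because of [u' = w u] and the Codazzi
    equation, the normal one is the equation for [w]. *)
Lemma surf_biharmonic : biharmonic L Om g X.
Proof.
intros Om' e eps HO' Hsub He s t Hst'.
assert (Hst := Hsub s t Hst'); assert (Hs := proj1 Hst).
assert (Hu : forall s, I s -> is_derive u s (wfun L theta s * u s))
  by (intros; apply ufun_is_derive with I; assumption).
assert (Hw := wfun_is_derive L I theta HIo Hth).
assert (Hk := k1_is_derive L I theta hL0 Hth).
assert (Ht := theta_is_derive L I theta Hth).
assert (Hc := cos_theta_is_derive L I theta Hth).
assert (Hn := sin_theta_is_derive L I theta Hth).
pose (p := fun s => - 2 * u s * sin (theta s)).
pose (q := fun s => 2 * u s * cos (theta s)).
pose (dp := fun s => - 2 * (wfun L theta s * u s) * sin (theta s)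
  - 2 * u s * (cos (theta s) * Derive theta s)).
pose (dq := fun s => 2 * (wfun L theta s * u s) * cos (theta s)
  - 2 * u s * (sin (theta s) * Derive theta s)).
assert (Hp : forall s, I s -> is_derive p s (dp s)).
{ intros x Hx; eapply is_derive_eq.
  - apply is_derive_mulR; [| apply Hn, Hx].
    apply is_derive_mulR; [apply is_derive_constR | apply Hu, Hx].
  - unfold dp; ring. }
assert (Hq : forall s, I s -> is_derive q s (dq s)).
{ intros x Hx; eapply is_derive_eq.
  - apply is_derive_mulR; [| apply Hc, Hx].
    apply is_derive_mulR; [apply is_derive_constR | apply Hu, Hx].
  - unfold dq; ring. }
(* [(p, q)] is [2 u xi]; its derivative along [s] is [2 (u' xi - u k1 X_s)]. *)
eassert (Hp1 : is_derive (fun s => dp s - q s * (sin (theta s) / L)) s _).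
{ apply is_derive_ext with (fun s =>
    - 2 * wfun L theta s * u s * sin (theta s)
    + - 2 * u s * cos (theta s) * k1 L theta s).
  { intros x; unfold dp, q, k1, Rdiv; simpl; ring. }
  apply is_derive_addR.
  * apply is_derive_mulR; [| apply Hn, Hs].
    apply is_derive_mulR; [| apply Hu, Hs].
    apply is_derive_mulR; [apply is_derive_constR | apply Hw, Hs].
  * apply is_derive_mulR; [| apply Hk, Hs].
    apply is_derive_mulR; [| apply Hc, Hs].
    apply is_derive_mulR; [apply is_derive_constR | apply Hu, Hs]. }
eassert (Hq1 : is_derive (fun s => dq s + p s * (sin (theta s) / L)) s _).
{ apply is_derive_ext with (fun s =>
    2 * wfun L theta s * u s * cos (theta s)
    + - 2 * u s * sin (theta s) * k1 L theta s).
  { intros x; unfold dq, p, k1, Rdiv; simpl; ring. }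
  apply is_derive_addR.
  * apply is_derive_mulR; [| apply Hc, Hs].
    apply is_derive_mulR; [| apply Hu, Hs].
    apply is_derive_mulR; [apply is_derive_constR | apply Hw, Hs].
  * apply is_derive_mulR; [| apply Hk, Hs].
    apply is_derive_mulR; [| apply Hn, Hs].
    apply is_derive_mulR; [apply is_derive_constR | apply Hu, Hs]. }
unfold bitension.
rewrite (curvature_term_normal L Om' g X e eps (lambda2 L u0 theta s));
  [| exact hL0 | exact He | exact Hst' | apply surf_AdS3 | | | | ].
- rewrite surf_tension by exact Hst; fold p q.
  rewrite (rough_laplacian_frame_field Om' e eps (tension L g X) p q dp dq
    _ _ s t HO' Hsub He Hst' Hp Hq Hp1 Hq1 surf_tension).
  unfold frame_field; unfold vsub at 1.
  rewrite !profile_vec_scal, profile_vec_add by auto.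
  rewrite <- (profile_vec_0 L (r s) (Z s) t) by auto.
  f_equal.
  (* Along the first frame vector the identity needs [cos^2 + sin^2 = 1]. *)
  + transitivity (lambda2 L u0 theta s
      * (- (2 * u s * sin (theta s) / L ^ 2)
         * (cos (theta s) ^ 2 + sin (theta s) ^ 2 - 1)));
      [| rewrite Hcn; ring].
    unfold p, q, dp, dq, k1; field; exact hL0.
  + unfold p, q, dp, dq, k1; field; exact hL0.
- intros i; rewrite surf_pd4 by exact Hs; apply ip_tangent_surf.
- intros i j; apply pullback_conformal, Hs.
- rewrite surf_tension by exact Hst; apply ip_profile_point; auto.
- intros i; rewrite surf_tension, surf_pd4 by assumption.
  destruct i; simpl; unfold frame_field;
    [rewrite ip_profile_profile by auto; ring | apply ip_profile_orbit; auto].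
Qed.

(** The tension field [2 u xi] has the square [4 u^2]. *)
Lemma surf_not_harmonic : ~ harmonic L Om g X.
Proof.
intros Hh; destruct (proj1 (proj2 HJ)) as [t Ht].
assert (Hst : Om 0 t) by (split; assumption).
assert (E : ip (tension L g X 0 t) (tension L g X 0 t) = 0)
  by (rewrite Hh by exact Hst; unfold ip; simpl; ring).
rewrite surf_tension in E by exact Hst; unfold frame_field in E.
rewrite ip_profile_profile in E by auto.
assert (Hu : u 0 <> 0).
{ intros Hu; assert (H := Hlam 0 HI0); unfold lambda2 in H; fold u in H.
  rewrite Hu in H; unfold Rdiv in H; lra. }
apply (pow_nonzero (u 0) 2 Hu).
replace (u 0 ^ 2) with
  (u 0 ^ 2 * (cos (theta 0) ^ 2 + sin (theta 0) ^ 2)) by (rewrite Hcn; ring).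
lra.
Qed.

Lemma surf_parabolic_symmetry : timelike_parabolic_symmetry Pt Om X.
Proof.
split; [exact parabolic_subgroup_Pt |]; split.
- exists (fun s => mkvec4 (r s) ((L ^ 2 + Z s ^ 2) / (2 * r s)) 0 (Z s)).
  intros s t _; apply vec4_eq; unfold X, surf, Pt; simpl; unfold r, Rdiv; ring.
- intros s t [Hs _]; rewrite surf_pd4, ip_tangent_tangent by exact Hs.
  unfold gsurf; fold (r s); assert (H := Hr0 s).
  assert (0 < r s ^ 2) by (apply pow2_gt_0, H); lra.
Qed.

End Surface.

Lemma theta_solution_sub L (I I0 : R -> Prop) theta :
  (forall s, I s -> I0 s) -> theta_solution L I0 theta ->
  theta_solution L I theta.
Proof. intros H Hth s Hs; apply Hth, H, Hs. Qed.

(** [lambda^2 = u / H] has the sign of [u0 H], as [u / u0] is an exponential. *)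
Lemma lambda2_pos L u0 theta s :
  0 < u0 * meanH L theta s -> meanH L theta s <> 0 /\ 0 < lambda2 L u0 theta s.
Proof.
intros H; assert (H0 : meanH L theta s <> 0)
  by (intros E; rewrite E in H; lra).
split; [exact H0 |].
replace (lambda2 L u0 theta s) with
  (u0 * meanH L theta s
   * exp (- RInt (fun x => Derive (meanH L theta) x / k1 L theta x) 0 s)
   * / meanH L theta s ^ 2)
  by (unfold lambda2, ufun; field; exact H0).
apply Rmult_lt_0_compat; [apply Rmult_lt_0_compat; [exact H | apply exp_pos] |].
apply Rinv_0_lt_compat, pow2_gt_0, H0.
Qed.

Lemma conformal_factor_pos_near_0 L u0 (I0 : R -> Prop) theta :
  L <> 0 -> open I0 -> I0 0 -> theta_solution L I0 theta ->
  0 < u0 * meanH L theta 0 ->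
  exists delta, 0 < delta /\ forall s, Rabs s < delta ->
    I0 s /\ meanH L theta s <> 0 /\ 0 < lambda2 L u0 theta s.
Proof.
intros hL HO H0 Hth Hpos.
assert (HM : continuous (fun s => u0 * meanH L theta s) 0).
{ apply smooth1_continuous with I0; [| exact H0].
  apply smooth1_mul; [exact HO | apply smooth1_const, HO |].
  apply smooth1_meanH; assumption. }
assert (Hloc : locally 0 (fun s => I0 s /\ 0 < u0 * meanH L theta s)).
{ apply filter_and; [exact (HO 0 H0) |].
  apply (HM (fun y => 0 < y)), (open_gt 0), Hpos. }
destruct Hloc as [d Hd]; exists d; split; [apply cond_pos |].
intros s Hs; destruct (Hd s) as [HIs HMs].
- unfold ball; simpl; unfold AbsRing_ball, abs, minus, plus, opp; simpl.
  rewrite Ropp_0, Rplus_0_r; exact Hs.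
- split; [exact HIs | apply lambda2_pos, HMs].
Qed.

Theorem proposition5p10 (L rho0 Z0 : R) (hL : 0 < L) (hrho0 : 0 < rho0) :
  (forall (I J : R -> Prop) (theta Z : R -> R),
     is_open_interval I -> I 0 -> is_open_interval J ->
     theta_solution L I theta ->
     Z_solution L Z0 I theta Z ->
     let X := surf L rho0 theta Z in
     maps_to_AdS3 L (rect I J) X /\
     induced_metric (rect I J) X (gsurf L rho0 theta) /\
     exists (xi : R -> R -> vec4) (A : endo),
       unit_spacelike_normal (rect I J) X xi /\
       shape_operator L (rect I J) X xi A /\
       forall s t, rect I J s t ->
         principal_curvature A (coord i_s) (k1 L theta s) s t /\
         principal_curvature A (coord i_t) (k2 L theta s) s t)
  /\
  (forall (theta0 a0 b0 u0 : R) (I0 : R -> Prop) (theta : R -> R),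
     a0 + sin theta0 / L <> 0 ->
     a0 / 2 + sin theta0 / L <> 0 ->
     b0 / 2 + a0 * cos theta0 / L <> 0 ->
     a0 / 2 + sin theta0 / L <> - (a0 + sin theta0 / L) ->
     u0 / (a0 / 2 + sin theta0 / L) > 0 ->
     is_open_interval I0 -> I0 0 ->
     real_analytic I0 theta ->
     theta_solution L I0 theta ->
     theta 0 = theta0 -> Derive theta 0 = a0 -> Derive_n theta 2 0 = b0 ->
     exists delta : R, 0 < delta /\
       forall (I J : R -> Prop) (Z : R -> R),
         is_open_interval I -> I 0 -> (forall s, I s -> Rabs s < delta) ->
         is_open_interval J ->
         Z_solution L Z0 I theta Z ->
         let X := surf L rho0 theta Z in
         let g' : metric := fun i j s t =>
           / lambda2 L u0 theta s * gsurf L rho0 theta i j s t in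
         (forall s, I s -> 0 < lambda2 L u0 theta s) /\
         conformal_immersion L (rect I J) g' X /\
         proper_biharmonic L (rect I J) g' X /\
         timelike_parabolic_symmetry Pt (rect I J) X).

Proof.
assert (hL0 : L <> 0) by lra.
split.
- intros I J theta Z HI H0 HJ Hth HZ; cbv zeta.
  split; [| split].
  + apply (surf_maps_to_AdS3 L rho0 Z0); assumption.
  + apply (surf_induced_metric L rho0 Z0); assumption.
  + exists (normal_field L rho0 theta Z), (surf_shape L theta); split; [| split].
    * apply (normal_field_unit L rho0 Z0); assumption.
    * apply (surf_shape_operator L rho0 Z0); assumption.
    * intros s t _; apply surf_principal_curvatures.
- intros theta0 a0 b0 u0 I0 theta _ HH0 _ _ Hu0 HI0 HI00 _ Hth E0 E1 _.
  assert (EH : meanH L theta 0 = a0 / 2 + sin theta0 / L)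
    by (unfold meanH; rewrite E0, E1; reflexivity).
  destruct (conformal_factor_pos_near_0 L u0 I0 theta hL0 (proj1 HI0) HI00 Hth)
    as (delta & Hdelta & Hnear).
  { rewrite EH; revert Hu0 HH0; generalize (a0 / 2 + sin theta0 / L).
    intros h Hu0 HH0; replace (u0 * h) with (u0 / h * h ^ 2) by (field; auto).
    apply Rmult_lt_0_compat; [exact Hu0 | apply pow2_gt_0, HH0]. }
  exists delta; split; [exact Hdelta |].
  intros I J Z HI H0 HId HJ HZ; cbv zeta.
  assert (Hth' : theta_solution L I theta).
  { apply theta_solution_sub with I0; [| exact Hth].
    intros s Hs; apply Hnear, HId, Hs. }
  assert (HH : forall s, I s -> meanH L theta s <> 0)
    by (intros s Hs; apply Hnear, HId, Hs).
  assert (Hlam : forall s, I s -> 0 < lambda2 L u0 theta s)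
    by (intros s Hs; apply Hnear, HId, Hs).
  split; [exact Hlam |]; split; [| split; [split |]].
  + apply (surf_conformal_immersion L rho0 Z0); assumption.
  + apply (surf_biharmonic L rho0 Z0); assumption.
  + apply (surf_not_harmonic L rho0 Z0); assumption.
  + apply (surf_parabolic_symmetry L rho0 Z0); assumption.
Qed.
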